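(* Let $n\ge 1$. The Schur–Szegő composition restricted to $Hyp_n^-$ induces a semigroup structure on the set of all ordered partitions of $n$: there is an associative binary operation $\ast$ on the set of ordered partitions of $n$ such that $MV_{P\ast Q}=MV_P\ast MV_Q$ for all $P,Q\in Hyp_n^-$. For example, for $n=17$, $$(2,14,1)\ast(5,6,6)=(1,1,2,1,1,1,3,1,1,1,3,1),$$ $$(1,14,2)\ast(5,6,4,2)=(1,2,1,1,1,3,1,1,1,1,1,1,1,1).$$
   Context: The Schur–Szegő composition (with respect to $n$) of $P(x)=\sum_{i=0}^n\binom{n}{i}a_ix^i$ and $Q(x)=\sum_{i=0}^n\binom{n}{i}b_ix^i$ is $P\ast Q(x)=\sum_{i=0}^n\binom{n}{i}a_ib_ix^i$. $Hyp_n^-$ is the set of real polynomials of degree $n$ all of whose roots are real and negative. An ordered partition of $n$ is a finite sequence of positive integers with sum $n$. For a real polynomial $P$ of degree $n$ with only real roots, the multiplicity vector $MV_P$ is the ordered partition of $n$ formed by the multiplicities of the distinct roots of $P$ listed in increasing order of the roots. *)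

(* Defs.v *)
From HB Require Import structures.
From mathcomp Require Import all_boot all_order all_algebra.
From mathcomp Require Import polyrcf complex.

Set Implicit Arguments.
Unset Strict Implicit.
Unset Printing Implicit Defensive.
Import Order.TTheory GRing.Theory Num.Theory.
Local Open Scope ring_scope.

Definition is_ordered_partition (n : nat) (s : seq nat) : bool :=
  all (fun m => 0 < m)%N s && (sumn s == n).

Record ordered_partition (n : nat) := OrderedPartition {
  parts :> seq nat;
  _ : is_ordered_partition n parts }.

HB.instance Definition _ (n : nat) := [isSub for @parts n].
HB.instance Definition _ (n : nat) := [Countable of ordered_partition n by <:].

(* With [P = \sum_(i < n.+1) 'C(n, i)%:R * a_i *: 'X^i], this is [a_i]. *)
Definition binomial_coef (R : fieldType) (n : nat) (P : {poly R}) (i : nat) : R :=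
  P`_i / 'C(n, i)%:R.

Definition schur_szego (R : fieldType) (n : nat) (P Q : {poly R}) : {poly R} :=
  \poly_(i < n.+1)
    ('C(n, i)%:R * binomial_coef n P i * binomial_coef n Q i).

(* Real polynomials of degree [n] all of whose complex roots are real. *)
Record hyperbolic (R : rcfType) (n : nat) := Hyperbolic {
  hyp_poly :> {poly R};
  hyp_size : size hyp_poly = n.+1;
  hyp_real : forall z : R[i],
    root (map_poly (real_complex R) hyp_poly) z -> z \is Num.real }.

(* The set Hyp_n^-. Since the roots are already real, negativity is stated on
   roots in [R]. *)
Record hyp_neg (R : rcfType) (n : nat) := HypNeg {
  hyp_neg_val :> hyperbolic R n;
  hyp_neg_lt0 : forall x : R, root hyp_neg_val x -> x < 0 }.

(* [rootsR P] lists the distinct roots of [P] in strictly increasing order. *)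
Definition mult_seq (R : rcfType) (P : {poly R}) : seq nat :=
  [seq mup x P | x <- rootsR P].

Lemma hyperbolic_split (R : rcfType) (n : nat) (P : hyperbolic R n) :
  exists2 s : seq R, size s = n &
    (P : {poly R}) = lead_coef P *: \prod_(x <- s) ('X - x%:P).
Proof.
case: P => P szP realP /=.
have [r defP] := closed_field_poly_normal (map_poly (real_complex R) P).
have P0 : P != 0 by rewrite -size_poly_eq0 szP.
have lP0 : lead_coef (map_poly (real_complex R) P) != 0.
  by rewrite lead_coef_eq0 map_poly_eq0.
have r_real z : z \in r -> z = (real_complex R) (complex.Re z).
  move=> zr; have /realP : root (map_poly (real_complex R) P) z.
    by rewrite defP rootZ // root_prod_XsubC.
  by move/RRe_real.
have E : P = lead_coef P *: \prod_(x <- map (@complex.Re R) r) ('X - x%:P).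
  apply: (map_poly_inj (real_complex R)).
  rewrite {1}defP map_polyZ lead_coef_map; congr (_ *: _).
  rewrite map_prod_XsubC big_map big_seq [RHS]big_seq.
  by apply: eq_bigr => z /r_real {1}->.
exists (map (@complex.Re R) r) => //.
have := congr1 (fun p : {poly R} => size p) E.
rewrite /= szP size_scale ?lead_coef_eq0 // size_prod_XsubC.
by case.
Qed.

Lemma mult_seqP (R : rcfType) (n : nat) (P : hyperbolic R n) :
  is_ordered_partition n (mult_seq P).
Proof.
have P0 : (P : {poly R}) != 0 by rewrite -size_poly_eq0 hyp_size.
have memr x : x \in rootsR P = root P x.
  by rewrite -(roots_on_rootsR P0) inE andTb.
apply/andP; split.
  apply/allP => m /mapP [x xr ->].
  by rewrite -XsubC_dvd // dvdp_XsubCl -memr.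
have [s szs E] := hyperbolic_split P.
have lP0 : lead_coef P != 0 by rewrite lead_coef_eq0.
have mupE x : mup x P = count_mem x s.
  rewrite E -mul_polyC mupMr ?rootC //; exact: mu_prod_XsubC.
have roots_undup : perm_eq (rootsR P) (undup s).
  apply: uniq_perm; rewrite ?undup_uniq ?uniq_roots // => x.
  by rewrite memr mem_undup E rootZ // root_prod_XsubC.
apply/eqP; rewrite /mult_seq (eq_map mupE).
rewrite (perm_sumn (perm_map _ roots_undup)).
rewrite -szs -[RHS](perm_size (perm_count_undup s)) size_flatten /shape.
rewrite -map_comp; congr sumn; apply: eq_map => x /=.
by rewrite size_nseq.
Qed.

Definition MV (R : rcfType) (n : nat) (P : hyperbolic R n) :
  ordered_partition n := OrderedPartition (mult_seqP P).

(* Hyp_n^- is closed under composition, and taking multiplicity vectors carries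
   composition to [op]. *)
Definition induced_by_schur_szego (R : rcfType) (n : nat)
    (op : ordered_partition n -> ordered_partition n -> ordered_partition n) :
    Prop :=
  forall P Q : hyp_neg R n, exists PQ : hyp_neg R n,
    (PQ : {poly R}) = schur_szego n P Q /\ MV PQ = op (MV P) (MV Q).

(* Main.v *)
From HB Require Import structures.
Require Import Defs.
From mathcomp Require Import all_boot all_order all_algebra reals.
From mathcomp Require Import polyrcf complex ring lra zify.

(** With [P = \prod (X + a)], a > 0, the value at [t] of n! (P * Q) is obtained
    from Q by applying, for each [a], the polar derivative
    n Q - (X - t / a) Q', times [a] ([horner_ssc_XaddC]).

    Polar derivatives at points of the closed upper half-plane preserve the
    polynomials without zeros in the open upper half-plane, so P * Q is
    hyperbolic.  For real [t] the same recursion reduces the inequality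
    f' g - f g' >= g^2, where f = n! (P * Q) and g = (n-1)! (P / (X + a) * Q'),
    to quadratic Q.  Hence f and g interlace, which by induction on n gives
    for the absolute values of the roots
    #{c > a b} <= #{a' > a} + #{b' > b}, and likewise with < for >.

    At a multiple root of P * Q the inequality forces g = 0 for every [a], so a
    composite of polar derivatives kills Q; this produces roots -a and -b of
    multiplicities m + q > n with a b the absolute value of the root, whose
    multiplicity is then m + q - n.  Together with the root counts, the
    multiplicity vector of P * Q is determined by those of P and Q, and
    associativity is inherited from the composition of polynomials. *)

Set Implicit Arguments.
Unset Strict Implicit.
Unset Printing Implicit Defensive.
Import Order.TTheory GRing.Theory Num.Theory.
Local Open Scope ring_scope.

(** * Algebra of the composition and of polar derivatives *)

Section Field.
Variable F : fieldType.
Implicit Types (p q : {poly F}) (s : seq F).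

(* n! times the Schur-Szego composition; this scaling keeps the recursions
   [deriv_ssc] and [ssc_XaddC] free of denominators. *)
Definition ssc n p q : {poly F} :=
  \poly_(i < n.+1) ((i`! * (n - i)`!)%:R * p`_i * q`_i).

(** Laguerre's polar derivative with pole [t]. The degree [n] is a formal one: [q] may have smaller
    degree, its missing roots then being at infinity. *)
Definition polar n t q : {poly F} := n%:R *: q - ('X - t%:P) * q^`().

(* [s] lists the opposites of the roots. *)
Definition mono s : {poly F} := \prod_(a <- s) ('X + a%:P).

Lemma coef_ssc n p q i :
  (ssc n p q)`_i = if (i < n.+1)%N then (i`! * (n - i)`!)%:R * p`_i * q`_i else 0.
Proof. by rewrite coef_poly. Qed.

Lemma sscC n p q : ssc n p q = ssc n q p.
Proof. by apply/polyP => i; rewrite !coef_ssc mulrAC. Qed.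

Lemma ssc_is_linear n p : linear (ssc n p).
Proof.
move=> c q r; apply/polyP => i; rewrite !(coef_ssc, coefD, coefZ).
case: ifP => _; last by rewrite mulr0 addr0.
by move: (_%:R : F) => x; ring.
Qed.
HB.instance Definition _ n p :=
  GRing.isLinear.Build F {poly F} {poly F} _ (ssc n p) (ssc_is_linear n p).

Lemma coef_derivM p i : p^`()`_i = i.+1%:R * p`_i.+1.
Proof. by rewrite coef_deriv mulr_natl. Qed.

Lemma deriv_ssc n p q : (ssc n.+1 p q)^`() = ssc n p^`() q^`().
Proof.
apply/polyP => i; rewrite coef_derivM !coef_ssc !coef_derivM ltnS subSS.
case: ifP => _; last by rewrite mulr0.
rewrite factS !natrM.
move: (i`!%:R : F) ((n - i)`!%:R : F) (i.+1%:R : F) => x y z. ring.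
Qed.

(** The weight i! (n + 1 - i)! is i times the weight of index i - 1 at level n, and n + 1 - i times
    the weight of index i. The factor i turns [q] into its derivative, and n + 1 - i gives (n + 1) q
    - X q'. *)
Lemma ssc_XaddC n a p q : (size p <= n.+1)%N ->
  ssc n.+1 (('X + a%:P) * p) q =
  'X * ssc n p q^`() + a *: ssc n p (n.+1%:R *: q - 'X * q^`()).
Proof.
move=> sp; apply/polyP => i.
rewrite !(coef_ssc, coefD, coefZ, coefXM, mulrDl, coefCM, coefN, coef_derivM).
case: i => [|i] /=.
  rewrite !subn0 factS !natrM fact0.
  by move: (n`!%:R : F) (n.+1%:R : F) => x y; ring.
rewrite !subSS !ltnS.
case: ltngtP => [lin|lin|->]; rewrite ?mul0r ?mulr0 ?addr0 //.
  rewrite -[(n - i)%N](@subnSK i n) // !factS !natrM.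
  have -> : n.+1%:R = (n - i.+1).+1%:R + i.+1%:R :> F.
    by rewrite -natrD subnSK // addnS subnK // ltnW.
  move: (i`!%:R : F) ((n - i.+1)`!%:R : F) (i.+1%:R : F) ((n - i.+1).+1%:R : F).
  by move=> x y z w; ring.
(* Top index: the bound on the size of [p] kills its coefficient of index n + 1. *)
rewrite [p`_n.+1]nth_default // mulr0 addr0 factS !natrM.
by move: (n`!%:R : F) ((n - n)`!%:R : F) (n.+1%:R : F) => x y z; ring.
Qed.

Lemma horner_ssc_XaddC n (a : F) p q t : (size p <= n.+1)%N -> a != 0 ->
  (ssc n.+1 (('X + a%:P) * p) q).[t] = a * (ssc n p (polar n.+1 (t / a) q)).[t].
Proof.
move=> sp a0; rewrite ssc_XaddC //.
have -> : ssc n p (polar n.+1 (t / a) q) =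
    (t / a) *: ssc n p q^`() + ssc n p (n.+1%:R *: q - 'X * q^`()).
  rewrite -linearZ -linearD; congr (ssc n p _).
  by rewrite /polar -!mul_polyC; ring.
rewrite !(hornerD, hornerM, hornerX, hornerZ).
by field.
Qed.

Lemma size_ssc n p q : (size (ssc n p q) <= n.+1)%N.
Proof. exact: size_poly. Qed.

(** The coefficients of X^(n + 1) in (n + 1) q and in X q' cancel. *)
Lemma size_polar n t q : (size q <= n.+2)%N -> (size (polar n.+1 t q) <= n.+1)%N.
Proof.
move=> sq; apply/leq_sizeP => j nj.
rewrite coefB coefZ mulrBl coefB coefXM coefCM coef_derivM.
case: j nj => // j nj; rewrite coef_derivM.
have h : q`_j.+2 = 0 by rewrite nth_default // (leq_trans sq).
rewrite h /= !mulr0 subr0 -mulrBl.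
move: nj; rewrite leq_eqVlt => /orP[/eqP[->]|nj]; first by rewrite subrr mul0r.
by rewrite nth_default ?mulr0 // (leq_trans sq).
Qed.

Lemma deriv_polar n t q : (polar n.+1 t q)^`() = polar n t q^`().
Proof.
rewrite /polar derivB derivZ derivM derivB derivX derivC subr0 mul1r.
rewrite -!mul_polyC -!natr1 !polyCD.
by move: (n%:R)%:P (_^`()) => x y; ring.
Qed.

(** Both sides expand to an expression symmetric in [t] and [u]. In [polar_chain] this moves the
    polar derivative at 0 past the others. *)
Lemma polarC n u t q : polar n u (polar n.+1 t q) = polar n t (polar n.+1 u q).
Proof.
rewrite /polar !(derivB, derivZ, derivM, derivX, derivC, subr0, mul1r).
rewrite -!mul_polyC -!natr1 !polyCD.
by move: (n%:R)%:P q^`()^`() => x z; move: q^`() => y; ring.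
Qed.

Lemma mono_cons (a : F) s : mono (a :: s) = ('X + a%:P) * mono s.
Proof. by rewrite /mono big_cons. Qed.

Lemma ssc_nil q : ssc 0 (mono [::]) q = (q`_0)%:P.
Proof.
apply/polyP => i; rewrite coef_ssc coefC /mono big_nil ltnS leqn0.
by case: eqP => // ->; rewrite coef1 !mul1r.
Qed.

Lemma mono_XsubC s : mono s = \prod_(x <- map -%R s) ('X - x%:P).
Proof. by rewrite big_map; apply: eq_bigr => a _; rewrite polyCN opprK. Qed.

Lemma size_mono s : size (mono s) = (size s).+1.
Proof. by rewrite mono_XsubC size_prod_XsubC size_map. Qed.

Lemma mono_neq0 s : mono s != 0.
Proof. by rewrite -size_poly_eq0 size_mono. Qed.

Lemma root_mono s (x : F) : root (mono s) x = (- x \in s).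
Proof.
by rewrite mono_XsubC root_prod_XsubC -{1}[x]opprK mem_map //; exact: oppr_inj.
Qed.

Lemma mup_mono s (x : F) : mup x (mono s) = count_mem (- x) s.
Proof.
rewrite mono_XsubC mu_prod_XsubC count_map; apply: eq_count => a /=.
by rewrite eqr_oppLR.
Qed.

Lemma perm_mono s s' : perm_eq s s' -> mono s = mono s'.
Proof. exact: perm_big. Qed.

Lemma mono_rem (b : F) s : b \in s -> mono s = ('X + b%:P) * mono (rem b s).
Proof. by move=> bs; rewrite -mono_cons; apply/perm_mono/perm_to_rem. Qed.

Lemma deriv_mono s : (mono s)^`() = \sum_(b <- s) mono (rem b s).
Proof.
elim: s => [|a s IHs]; first by rewrite /mono !big_nil derivC.
rewrite mono_cons derivM derivD derivX derivC addr0 mul1r IHs big_cons /= eqxx.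
congr (_ + _); rewrite mulr_sumr big_seq [RHS]big_seq; apply: eq_bigr => b bs.
case: eqVneq bs => [->|_] bs; rewrite -mono_cons //.
by apply/perm_mono; rewrite perm_sym perm_to_rem.
Qed.

(** Each [b] contributes the product without [b], times (X + b) - (X - t) = t + b. *)
Lemma polar_mono s (t : F) :
  polar (size s) t (mono s) = \sum_(b <- s) (t + b) *: mono (rem b s).
Proof.
rewrite /polar deriv_mono mulr_sumr.
have -> : (size s)%:R *: mono s = \sum_(b <- s) mono s.
  by rewrite big_const_seq count_predT iter_addr_0 scaler_nat.
rewrite -sumrB big_seq [RHS]big_seq; apply: eq_bigr => b bs.
by rewrite {1}(mono_rem bs) -mul_polyC polyCD; ring.
Qed.
End Field.

(** * Logarithmic derivatives and zeros in the upper half-plane *)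

Lemma horner_deriv_prod_XsubC (F : fieldType) (r : seq F) z : z \notin r ->
  (\prod_(x <- r) ('X - x%:P))^`().[z] =
  (\prod_(x <- r) ('X - x%:P)).[z] * \sum_(x <- r) (z - x)^-1.
Proof.
elim: r => [|a r IHr]; first by rewrite !big_nil derivC hornerC mulr0.
rewrite inE negb_or => /andP[za zr].
rewrite !big_cons derivM derivXsubC mul1r hornerD !hornerM IHr // hornerXsubC.
by have za0 : z - a != 0; [rewrite subr_eq0 | field].
Qed.

(** The degenerate case of Laguerre's theorem: all the roots sit at the pole. *)
Lemma polar_XsubCX (F : fieldType) n (t c : F) :
  polar n t (c *: ('X - t%:P) ^+ n) = 0.
Proof.
rewrite /polar derivZ deriv_exp derivXsubC mul1r -scaler_nat -!scalerAr.
case: n => [|n]; first by rewrite !scale0r scaler0 subr0.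
by rewrite -exprS !scalerA [c * _]mulrC subrr.
Qed.

Section LowerHalfPlane.
Variable C : numClosedFieldType.
Implicit Types (q : {poly C}) (z t : C).

Definition lower q := forall z, root q z -> 'Im z <= 0.

Lemma lower_neq0 q : lower q -> q != 0.
Proof.
move=> lq; apply/eqP => q0; have := lq 'i; rewrite q0 root0 Im_i => /(_ isT).
by rewrite ler10.
Qed.

Lemma ImV_norm z : 'Im z^-1 = - 'Im z * `|z^-1| ^+ 2.
Proof. by rewrite ImV normfV exprVn. Qed.

Lemma norm_subC (u v : C) :
  `|u - v| ^+ 2 = `|u| ^+ 2 + `|v| ^+ 2 - (u * v^* + u^* * v).
Proof. by rewrite !normCK rmorphB /=; ring. Qed.

(* With u_x = 1 / (z - x) for the roots x and v = 1 / (z - t), a zero z of the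
   polar derivative is the equation sum u_x = n v, while the position of the
   x, t and z with respect to the real axis gives sum |u_x|^2 <= n |v|^2; hence
   sum |u_x - v|^2 <= 0. *)
Lemma polar_root_eq0 n q z t :
  (size q <= n.+1)%N -> lower q -> 0 <= 'Im t -> 0 < 'Im z ->
  root (polar n t q) z -> polar n t q = 0.
Proof.
case: n => [|n] sq lq t0 z0 rz.
  by rewrite /polar scale0r (size1_polyC sq) derivC mulr0 subr0.
have q0 := lower_neq0 lq.
have qz : q.[z] != 0 by apply: contraL z0 => /lq /le_gtF ->.
have [r defq] := closed_field_poly_normal q.
set c := lead_coef q in defq.
have c0 : c != 0 by rewrite lead_coef_eq0.
have sr : (size r <= n.+1)%N.
  by move: sq; rewrite defq size_scale // size_prod_XsubC.
have zr : z \notin r.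
  by apply: contra qz => zr; rewrite defq -rootE rootZ // root_prod_XsubC.
have zt : z - t != 0.
  apply: contraNneq qz => zt; move: rz; rewrite rootE /polar !hornerE zt mul0r.
  by rewrite subr0 mulf_eq0 pnatr_eq0.
pose u x := (z - x)^-1; pose v := (z - t)^-1.
have v0 : v != 0 by rewrite invr_eq0.
have dq : q^`().[z] = q.[z] * \sum_(x <- r) u x.
  by rewrite defq derivZ !hornerZ horner_deriv_prod_XsubC // mulrA.
have su : \sum_(x <- r) u x = n.+1%:R * v.
  move: rz; rewrite rootE /polar !hornerE dq subr_eq0 => /eqP e.
  apply: (mulfI qz); apply: (mulfI zt); rewrite -[RHS]/((z - t) * (q.[z] * _)).
  by rewrite -{}e /v; field.
have nu : \sum_(x <- r) `|u x| ^+ 2 <= n.+1%:R * `|v| ^+ 2.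
  rewrite -(ler_pM2l z0).
  apply: (@le_trans _ _ (- 'Im (\sum_(x <- r) u x))).
    rewrite raddf_sum -sumrN mulr_sumr big_seq [X in _ <= X]big_seq.
    apply: ler_sum => x xr; rewrite /= ImV_norm mulNr opprK.
    rewrite ler_wpM2r ?exprn_ge0 // raddfB /= lerBrDr gerDl.
    by apply: lq; rewrite defq rootZ // root_prod_XsubC.
  rewrite su ImMl ?realn // ImV_norm -mulrN [leRHS]mulrCA ler_wpM2l ?ler0n //.
  rewrite mulNr opprK ler_wpM2r ?exprn_ge0 // raddfB /=.
  by rewrite gerBl.
(* The second term accounts for a degree of [q] below the formal one: the missing roots lie at
   infinity, where u_x = 0. *)
have E : \sum_(x <- r) `|u x - v| ^+ 2 + (n.+1 - size r)%:R * `|v| ^+ 2 <= 0.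
  under eq_bigr do rewrite norm_subC.
  have suC : \sum_(x <- r) (u x)^* = n.+1%:R * v^*.
    by rewrite -[RHS]conjCK rmorphM /= conjCK rmorph_nat -su !rmorph_sum.
  rewrite sumrB !big_split /=.
  rewrite -[\sum_(i <- r) u i * _]mulr_suml -[\sum_(i <- r) (u i)^* * v]mulr_suml.
  rewrite su suC.
  rewrite big_const_seq count_predT iter_addr_0 natrB //.
  rewrite -[_ *+ size r]mulr_natl !normCK in nu *.
  by move: nu; rewrite -subr_le0; congr (_ <= _); ring.
have E1 : \sum_(x <- r) `|u x - v| ^+ 2 >= 0.
  by apply: sumr_ge0 => x _; rewrite exprn_ge0.
have E2 : (n.+1 - size r)%:R * `|v| ^+ 2 >= 0 by rewrite mulr_ge0 ?exprn_ge0.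
have /eqP := le_anti (introT andP (conj E (addr_ge0 E1 E2))).
rewrite paddr_eq0 // mulf_eq0 expf_eq0 normr_eq0 (negPf v0) orbF pnatr_eq0.
rewrite psumr_eq0; last by move=> x _; rewrite exprn_ge0.
case/andP => /allP h; rewrite subn_eq0 => sr'.
have rt : r = nseq n.+1 t.
  rewrite -(anti_leq (introT andP (conj sr sr'))); apply/all_pred1P/allP => x xr /=.
  have /implyP/(_ isT) := h _ xr; rewrite expf_eq0 normr_eq0 subr_eq0 /=.
  move=> /eqP /invr_inj /eqP.
  by rewrite (inj_eq (addrI z)) eqr_opp => /eqP ->.
by rewrite defq rt big_nseq iter_mulr_1 polar_XsubCX.
Qed.

Lemma lower_polar n q t : (size q <= n.+1)%N -> lower q -> 0 <= 'Im t ->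
  polar n t q != 0 -> lower (polar n t q).
Proof.
move=> sq lq t0 p0 z rz; rewrite real_leNgt ?Creal_Im //.
by apply: contra p0 => z0; rewrite (polar_root_eq0 sq lq t0 z0 rz).
Qed.

(** Induction on [s]: a factor X + a becomes a polar derivative at z / a, which stays in the open
    upper half-plane because a > 0, so [lower] is preserved. *)
Lemma ssc_lower_neq0 s q z : all (fun a => 0 < a) s -> lower q ->
  (size q <= (size s).+1)%N -> 0 < 'Im z -> (ssc (size s) (mono s) q).[z] != 0.
Proof.
move=> + + + z0; elim: s q => [|a s IHs] q /=.
  move=> _ lq sq; have := lower_neq0 lq; rewrite (size1_polyC sq) polyC_eq0.
  by rewrite ssc_nil hornerC coefC.
case/andP=> a0 sp lq sq; have an0 := lt0r_neq0 a0.
rewrite mono_cons horner_ssc_XaddC ?size_mono // mulf_neq0 //.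
have iz : 0 < 'Im (z / a).
  by rewrite ImMr ?realV ?gtr0_real // mulr_gt0 ?invr_gt0.
apply: IHs => //; last exact: size_polar.
apply: lower_polar => //; first exact: ltW.
(* At its own pole the polar derivative is a positive multiple of [q], which does not vanish
   there. *)
apply/eqP => p0; have := congr1 (fun p => p.[z / a]) p0.
rewrite /polar !hornerE subrr mul0r subr0 => /eqP.
rewrite mulf_eq0 pnatr_eq0 /= => /lq /le_gtF; by rewrite iz.
Qed.
End LowerHalfPlane.

(** * Real-rooted polynomials and their stability under composition *)

Section RealRooted.
Variable R : rcfType.
Local Notation C := R[i].
Local Notation cpx := (map_poly (real_complex R)).
Implicit Types (p q : {poly R}) (s : seq R).

Definition real_rooted q := forall z : C, root (cpx q) z -> z \is Num.real.

Lemma Im_real_complex (a : R) : 'Im (real_complex R a) = 0.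
Proof. by apply/Creal_ImP; rewrite complex_real. Qed.

Lemma cpx_root_conj q (z : C) : root (cpx q) z -> root (cpx q) z^*.
Proof.
have defq : cpx q = map_poly Num.conj (cpx q).
  rewrite -map_poly_comp; apply: eq_map_poly => a /=.
  by rewrite conj_Creal // complex_real.
by move=> rz; rewrite defq rootE horner_map (eqP rz) rmorph0.
Qed.

(** The zeros of a real polynomial are closed under conjugation, so none in the upper half-plane
    means none in the lower one. *)
Lemma lower_real_rooted q : lower (cpx q) -> real_rooted q.
Proof.
move=> lq z rz; apply/Creal_ImP/eqP; rewrite eq_le lq //.
by rewrite -oppr_le0 -Im_conj lq // cpx_root_conj.
Qed.

Lemma real_rooted_lower q : real_rooted q -> lower (cpx q).
Proof. by move=> rq z /rq /Creal_ImP ->. Qed.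

Lemma cpx_ssc n p q : cpx (ssc n p q) = ssc n (cpx p) (cpx q).
Proof.
apply/polyP => i; rewrite coef_map !coef_ssc; case: ifP => _; last exact: rmorph0.
by rewrite !coef_map /= !natrM !rmorphM !rmorph_nat.
Qed.

Lemma cpx_mono s : cpx (mono s) = mono (map (real_complex R) s).
Proof.
rewrite /mono big_map rmorph_prod; apply: eq_bigr => a _.
by rewrite rmorphD /= map_polyX map_polyC.
Qed.

Lemma cpx_polar n (t : R) q : cpx (polar n t q) = polar n (real_complex R t) (cpx q).
Proof.
by rewrite /polar rmorphB rmorphM rmorphB /= map_polyZ map_polyX
  map_polyC deriv_map rmorph_nat.
Qed.

Lemma real_rooted_neq0 q : real_rooted q -> q != 0.
Proof. by move/real_rooted_lower/lower_neq0; rewrite map_poly_eq0. Qed.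

Lemma real_rooted_polar n t q : (size q <= n.+1)%N -> real_rooted q ->
  polar n t q != 0 -> real_rooted (polar n t q).
Proof.
move=> sq rq p0; apply: lower_real_rooted; rewrite cpx_polar.
apply: lower_polar; first by rewrite size_map_poly.
- exact: real_rooted_lower.
- by rewrite Im_real_complex.
by rewrite -cpx_polar map_poly_eq0.
Qed.

Lemma real_rooted_ssc s q : all (fun a => 0 < a) s -> real_rooted q ->
  (size q <= (size s).+1)%N -> real_rooted (ssc (size s) (mono s) q).
Proof.
move=> sp rq sq; apply: lower_real_rooted => z.
rewrite real_leNgt ?Creal_Im //; apply: contraL => z0.
rewrite rootE cpx_ssc cpx_mono -(size_map (real_complex R) s).
apply: ssc_lower_neq0 => //; last by rewrite size_map size_map_poly.
  by rewrite all_map; apply: sub_all sp => a /=; rewrite ltcR.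
exact: real_rooted_lower.
Qed.

Lemma real_rooted_split q : real_rooted q ->
  exists c s, c != 0 /\ q = c *: mono s.
Proof.
move=> rq; have q0 := real_rooted_neq0 rq.
have [r defq] := closed_field_poly_normal (cpx q).
rewrite lead_coef_map in defq.
have lq0 : lead_coef q != 0 by rewrite lead_coef_eq0.
exists (lead_coef q), (map (fun z => - complex.Re z) r); split=> //.
apply: (map_poly_inj (real_complex R)); rewrite {1}defq map_polyZ /=.
congr (_ *: _); rewrite cpx_mono /mono -map_comp big_map big_seq [RHS]big_seq.
apply: eq_bigr => z zr /=; rewrite -[z in LHS]RRe_real ?rmorphN ?opprK //.
by apply: rq; rewrite defq rootZ ?root_prod_XsubC // fmorph_eq0.
Qed.

Lemma real_rooted_mono c s : c != 0 -> real_rooted (c *: mono s).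
Proof.
move=> c0 z; rewrite map_polyZ rootZ ?fmorph_eq0 // cpx_mono root_mono.
by case/mapP => a _ /eqP; rewrite eqr_oppLR => /eqP ->; rewrite realN complex_real.
Qed.
End RealRooted.

(** * A Wronskian inequality for composites *)

Section Wronskian.
Variable R : rcfType.
Implicit Types (p q : {poly R}) (s : seq R).

Lemma real_rooted_discriminant q : (size q <= 3)%N -> real_rooted q ->
  4%:R * q`_0 * q`_2 <= q`_1 ^+ 2.
Proof.
move=> sq /real_rooted_split[c [s [c0 defq]]].
have : (size s <= 2)%N by move: sq; rewrite defq size_scale // size_mono.
rewrite {}defq !coefZ; case: s => [|a [|b [|//]]] _.
- by rewrite /mono big_nil !coef1 !mulr0 expr0n.
- rewrite mono_cons /mono big_nil mulr1 !coefD !coefX !coefC /= !addr0 add0r.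
  by rewrite !mulr0 sqr_ge0.
rewrite !mono_cons /mono big_nil mulr1 !mulrDl !coefD !coefXM !coefCM !coefD.
rewrite !coefX !coefC /= !(addr0, add0r, mulr0, mulr1).
by rewrite -subr_ge0; have := sqr_ge0 (c * (a - b)); congr (_ <= _); ring.
Qed.

Lemma ssc_bracket (a b : R) s q t : 0 < a -> 0 < b -> all (fun c => 0 < c) s ->
  (size q <= (size s).+3)%N -> (q != 0 -> real_rooted q) ->
  (ssc (size s).+2 (mono (a :: b :: s)) q).[t] *
    (ssc (size s) (mono s) q^`()^`()).[t] <=
  (ssc (size s).+1 (mono (a :: s)) q^`()).[t] *
    (ssc (size s).+1 (mono (b :: s)) q^`()).[t].
Proof.
move=> a0 b0; elim: s q => [|c s IHs] q /=.
  move=> _ sq rq; have {rq} disc : 4%:R * q`_0 * q`_2 <= q`_1 ^+ 2.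
    have [->|/rq] := eqVneq q 0; first by rewrite !coef0 !mulr0 sqr_ge0.
    exact: real_rooted_discriminant.
  rewrite !mono_cons !ssc_XaddC -?mono_cons ?size_mono // !ssc_nil.
  rewrite !(hornerD, hornerM, hornerZ, hornerX, hornerC).
  rewrite !(coefB, coefXM, coefZ, coef_derivM) /=.
  rewrite -subr_ge0.
  have := mulr_ge0 (mulr_ge0 (ltW a0) (ltW b0)) (etrans (subr_ge0 _ _) disc).
  by congr (_ <= _); ring.
case/andP => c0 sp sq rq; have cn0 := lt0r_neq0 c0.
have perm2 : mono [:: a, b, c & s] = mono [:: c, a, b & s].
  exact/perm_mono/permPl/(perm_catCA [:: a; b] [:: c] s).
have perm1 (d : R) : mono [:: d, c & s] = mono [:: c, d & s].
  exact/perm_mono/permPl/(perm_catCA [:: d] [:: c] s).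
rewrite perm2 !perm1 ![mono (c :: _)]mono_cons.
rewrite !horner_ssc_XaddC ?size_mono // -!deriv_polar.
rewrite mulrACA [leRHS]mulrACA; apply: ler_wpM2l.
  by rewrite mulr_ge0 ?ltW.
apply: IHs => //; first exact: size_polar.
have [->|q0 p0] := eqVneq q 0.
  by rewrite /polar scaler0 derivC mulr0 subr0 eqxx.
exact: real_rooted_polar (rq q0) _.
Qed.

Definition wronskian p q := p^`() * q - p * q^`().

(** Differentiating a product drops one factor at a time. With f and g the two composites, f' is g
    plus a sum over [b] in [s], and g' is a sum over the same [b]; hence f' g - f g' - g^2 is a sum
    of terms that [ssc_bracket] makes nonnegative. *)
Lemma ssc_wronskian (a : R) s q t : 0 < a -> all (fun c => 0 < c) s ->
  (size q <= (size s).+2)%N -> real_rooted q ->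
  (ssc (size s) (mono s) q^`()).[t] ^+ 2 <=
  (wronskian (ssc (size s).+1 (mono (a :: s)) q) (ssc (size s) (mono s) q^`())).[t].
Proof.
move=> a0 sp sq rq.
set f := ssc _.+1 _ _; set g := ssc _ _ _.
rewrite /wronskian !(hornerD, hornerN, hornerM).
have df : f^`() = g + \sum_(b <- s) ssc (size s) (mono (a :: rem b s)) q^`().
  rewrite /f deriv_ssc mono_cons derivM derivD derivX derivC addr0 mul1r.
  rewrite sscC linearD /= [ssc _ q^`() (mono s)]sscC; congr (_ + _).
  rewrite deriv_mono mulr_sumr linear_sum; apply: eq_bigr => b _ /=.
  by rewrite sscC mono_cons.
have dg : g^`() = \sum_(b <- s) ssc (size s).-1 (mono (rem b s)) q^`()^`().
  rewrite /g; case: (s) => [|b s'] /=.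
    by rewrite ssc_nil derivC big_nil.
  rewrite deriv_ssc deriv_mono sscC linear_sum.
  by apply: eq_bigr => d _; rewrite sscC.
rewrite df dg hornerD mulrDl -expr2 -addrA lerDl subr_ge0 !horner_sum.
rewrite mulr_suml mulr_sumr big_seq [leRHS]big_seq; apply: ler_sum => b bs.
have sr : size s = (size (rem b s)).+1 by rewrite size_rem //; case: (s) bs.
have perms := perm_to_rem bs.
have sp' := sp; rewrite (perm_all _ perms) /= in sp'; case/andP: sp' => b0 sp'.
rewrite /f /g !(perm_mono perms).
have -> : mono (a :: s) = mono [:: a, b & rem b s].
  by apply: perm_mono; rewrite perm_cons.
rewrite sr /=; apply: ssc_bracket => //; first by rewrite -sr.
Qed.
End Wronskian.

(** * Counting in interlacing sequences *)

Section CountInterlacing.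
Variable R : realDomainType.
Implicit Types (U : pred R) (s zs ws : seq R) (x y z : R).

Definition down_closed U := forall x y, x <= y -> U y -> U x.
Definition up_closed U := forall x y, x <= y -> U x -> U y.

Lemma count_le_lt z s :
  count (fun x => x <= z) s = (count (fun x => x < z)%R s + count_mem z s)%N.
Proof. by elim: s => //= x s ->; rewrite le_eqVlt; case: ltgtP => _ /=; lia. Qed.

Lemma count_gt_lt z s : size s =
  (count (fun x => x < z)%R s + count (fun x => z < x)%R s + count_mem z s)%N.
Proof. by elim: s => //= x s ->; case: ltgtP => _ /=; lia. Qed.

Lemma seq_has_max s : s != [::] -> exists2 z, z \in s & forall y, y \in s -> y <= z.
Proof.
elim: s => // x s IHs _; have [->|/IHs[z zs zP]] := eqVneq s [::].
  by exists x => [|y]; rewrite inE // => /eqP->.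
case: (lerP x z) => xz; [exists z|exists x]; rewrite ?inE ?zs ?eqxx ?orbT //.
  by move=> y /predU1P[->//|/zP].
by move=> y /predU1P[->//|/zP/le_trans->//]; rewrite ltW.
Qed.

Lemma count_down_closed U s : uniq s -> down_closed U -> has U s ->
  exists z, [/\ z \in s, U z & count U s = (count (fun x => x < z)%R s).+1].
Proof.
move=> us dU; rewrite has_filter => /seq_has_max[z].
rewrite mem_filter => /andP[Uz zs] zP; exists z; split=> //.
rewrite -addn1 -[in RHS](_ : count_mem z s = 1)%N; last by rewrite count_uniq_mem ?zs.
rewrite -count_le_lt; apply: eq_in_count => x xs; apply/idP/idP => [Ux|/dU->//].
by apply: zP; rewrite mem_filter Ux.
Qed.

(** From one element of [zs] to the next, the count of [zs] below grows by one; constant parity then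
    forces an element of [ws] in between. So the i-th element of [zs] has at least i - 1 elements of
    [ws] below it. *)
Lemma leq_count_parity zs ws (b : bool) U : uniq zs -> down_closed U ->
  (forall z, z \in zs ->
    odd (count (fun x => x < z)%R zs + count (fun x => x < z)%R ws) = b) ->
  (count U zs <= (count U ws).+1)%N.
Proof.
move=> uz dU parity.
have step V z : down_closed V -> V z ->
    (count (fun x => x < z)%R ws <= count V ws)%N.
  by move=> dV Vz; apply: sub_count => x /= /ltW /dV ->.
have dlt z : down_closed (fun x => x < z)%R by move=> x y; exact: le_lt_trans.
have main z : z \in zs ->
    (count (fun x => x < z)%R zs <= count (fun x => x < z)%R ws)%N.
  elim: {z}_.+1 {-2}z (ltnSn (count (fun x => x < z)%R zs)) => // k IHk z kz zz.
  have [|/hasPn no] := boolP (has (fun x => x < z)%R zs); last first.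
    by rewrite (eq_in_count (a2 := pred0)) ?count_pred0 // => x /no/negPf.
  move=> /(count_down_closed uz (dlt z))[y [yz ltyz cz]].
  have := IHk y _ yz; rewrite -ltnS -cz => /(_ kz).
  have := step _ _ (dlt z) ltyz; have := parity y yz; rewrite -(parity z zz) cz.
  by lia.
have [|/hasPn no] := boolP (has U zs); last first.
  by rewrite (eq_in_count (a2 := pred0)) ?count_pred0 // => x /no/negPf.
case/(count_down_closed uz dU) => z [zz Uz ->].
by rewrite ltnS (leq_trans (main z zz)) // step.
Qed.

(** Reflection x -> -x reduces this to [leq_count_parity]. Counts above z are complements of counts
    below, up to the multiplicity of z, so z has to avoid [ws]. *)
Lemma leq_count_parity_up zs ws (b : bool) U : uniq zs -> up_closed U ->
  (forall z, z \in zs -> z \notin ws /\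
    odd (count (fun x => x < z)%R zs + count (fun x => x < z)%R ws) = b) ->
  (count U zs <= (count U ws).+1)%N.
Proof.
move=> uz uU parity.
have mapK s : s = map -%R (map -%R s) by rewrite mapK //; exact: opprK.
rewrite [X in (count _ X <= _)%N]mapK [X in (_ <= (count _ X).+1)%N]mapK !(count_map _ U).
(* At each z of [zs], one element of [zs], namely z, is neither above nor below; hence the
   predecessor. *)
apply: (@leq_count_parity _ _ (b (+) odd ((size zs).-1 + size ws))).
- by rewrite map_inj_uniq //; exact: oppr_inj.
- by move=> x y; rewrite -lerN2 => /uU h /h.
move=> _ /mapP[z zz ->]; have [zw <-] := parity z zz.
rewrite !count_map.
have e s : count (preim -%R (fun x => x < - z)%R) s = count (fun x => z < x)%R s.
  by apply: eq_count => x /=; rewrite ltrN2.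
rewrite !e.
have := count_gt_lt z zs; have := count_gt_lt z ws.
rewrite (count_memPn zw) count_uniq_mem // zz /=.
by move=> -> ->; rewrite addn0 addn1 /= !oddD; do 4!case: (odd _).
Qed.
End CountInterlacing.

(** * Root counts from a Wronskian inequality *)

Section Interlacing.
Variable R : rcfType.
Implicit Types (f g h : {poly R}) (zs ws : seq R).

(** By continuity. It restores an inequality at the point where a common square factor was divided
    out. *)
Lemma poly_ge0_punctured h x : (forall t, t != x -> 0 <= h.[t]) -> 0 <= h.[x].
Proof.
move=> hP; rewrite leNgt; apply/negP => hx.
have hx' : 0 < - h.[x] by rewrite oppr_gt0.
have [d d0 dP] := poly_cont x h hx'.
have d2 : 0 < d / 2%:R by rewrite divr_gt0.
have /dP : `|x + d / 2%:R - x| < d by rewrite addrAC subrr add0r gtr0_norm //; lra.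
have : 0 <= h.[x + d / 2%:R].
  by apply: hP; rewrite -subr_eq0 addrAC subrr add0r lt0r_neq0.
by move=> h0 /ltr_normlW; lra.
Qed.

Lemma sgr_horner_mono s (z : R) : z \notin s ->
  Num.sg (mono s).[- z] = (-1) ^+ count (fun x => x < z)%R s.
Proof.
elim: s => [|a s IHs]; first by rewrite /mono big_nil hornerC sgr1.
rewrite inE negb_or mono_cons hornerM !hornerE sgrM => /andP[za /IHs ->] /=.
rewrite addrC; case: ltgtP za => // az _.
  by rewrite ltr0_sg ?subr_lt0 // mulN1r exprS mulN1r.
by rewrite gtr0_sg ?subr_gt0 // mul1r.
Qed.

Lemma mono_cat zs ws : mono (zs ++ ws) = mono zs * mono ws.
Proof. exact: big_cat. Qed.

Lemma wronskian_mono_common (c d z : R) zs ws : z \in zs -> z \in ws ->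
  wronskian (c *: mono zs) (d *: mono ws) =
  ('X + z%:P) ^+ 2 * wronskian (c *: mono (rem z zs)) (d *: mono (rem z ws)).
Proof.
move=> zz zw; rewrite /wronskian (mono_rem zz) (mono_rem zw).
rewrite !(derivZ, derivM, derivD, derivX, derivC) -!mul_polyC; ring.
Qed.

(* After removal of the common roots, the hypothesis gives f' g > 0 at the zeros
   of f, hence the parity of the number of zeros of f and g below a zero of f is
   constant. *)
Lemma interlacing_count (c d e : R) zs ws U :
  c != 0 -> d != 0 -> 0 < e -> up_closed U \/ down_closed U ->
  (forall t, e * (d *: mono ws).[t] ^+ 2 <=
             (wronskian (c *: mono zs) (d *: mono ws)).[t]) ->
  (count U zs <= (count U ws).+1)%N.
Proof.
move=> c0 d0 e0 cU; elim: {zs}_.+1 {-2}zs ws (ltnSn (size zs)) => // k IHk zs ws kz W.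
have [/hasP[z zz /= zw]|/hasPn disj] := boolP (has (mem ws) zs).
  rewrite (permP (perm_to_rem zz)) (permP (perm_to_rem zw)) /= -addnS leq_add2l.
  apply: IHk => [|t].
    by rewrite size_rem //; case: (zs) zz kz.
  rewrite -subr_ge0.
  pose h := wronskian (c *: mono (rem z zs)) (d *: mono (rem z ws)) -
            e *: (d *: mono (rem z ws)) ^+ 2.
  suff: 0 <= h.[t] by rewrite hornerD hornerN hornerZ horner_exp.
  have hP u : u != - z -> 0 <= h.[u].
    move=> uz; have := W u; rewrite (wronskian_mono_common _ _ zz zw) (mono_rem zw).
    rewrite hornerM horner_exp -subr_ge0 hornerZ hornerM.
    have -> : ('X + z%:P).[u] = u + z by rewrite !hornerE.
    have uz0 : 0 < (u + z) ^+ 2 by rewrite exprn_even_gt0 //= addr_eq0.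
    rewrite -(pmulr_rge0 h.[u] uz0); congr (_ <= _).
    by rewrite /h !(hornerD, hornerN, hornerZ, horner_exp); ring.
  by have [->|/hP//] := eqVneq t (- z); apply: poly_ge0_punctured.
have sgn z : z \in zs ->
    z \notin rem z zs ++ ws /\ 0 < c * d * (mono (rem z zs ++ ws)).[- z].
  move=> zz; have := W (- z); rewrite /wronskian.
  have z0 : (mono zs).[- z] = 0 by apply/eqP; rewrite -rootE root_mono opprK.
  have dz : (mono zs)^`().[- z] = (mono (rem z zs)).[- z].
    rewrite (mono_rem zz) derivM derivD derivX derivC addr0 mul1r.
    by rewrite hornerD hornerM hornerD hornerX hornerC addNr mul0r addr0.
  rewrite !(hornerD, hornerN, hornerM, hornerZ, derivZ) z0 dz mulr0 mul0r subr0 => h.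
  have wz : (mono ws).[- z] != 0 by rewrite -rootE root_mono opprK disj.
  have h0 : 0 < c * d * (mono (rem z zs ++ ws)).[- z].
    rewrite mono_cat hornerM; apply: lt_le_trans (_ : e * (d * (mono ws).[- z]) ^+ 2 <= _).
      by rewrite mulr_gt0 // exprn_even_gt0 //= mulf_neq0.
    by apply: le_trans h _; rewrite le_eqVlt; apply/orP; left; apply/eqP; ring.
  split=> //; apply/negP => zin; move: h0.
  by rewrite (rootP _) ?mulr0 ?ltxx // root_mono opprK.
have uz : uniq zs.
  apply: count_mem_uniq => x; have [xz|/count_memPn//] := boolP (x \in zs).
  have [] := sgn x xz; rewrite mem_cat negb_or => /andP[xr _] _.
  by rewrite (permP (perm_to_rem xz)) /= eqxx (count_memPn xr).
have parity z : z \in zs -> z \notin ws /\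
    odd (count (fun x => x < z)%R zs + count (fun x => x < z)%R ws) = (c * d < 0).
  move=> zz; split; first exact: disj.
  have [zn /gtr0_sg] := sgn z zz; rewrite sgrM sgr_horner_mono // count_cat.
  rewrite (permP (perm_to_rem zz)) /= ltxx add0n -signr_odd.
  have cd0 : c * d != 0 by rewrite mulf_neq0.
  have ne11 : (-1 == 1 :> R) = false by rewrite eqNr oner_eq0.
  case: ltgtP cd0 => // cd _; rewrite ?(ltr0_sg cd) ?(gtr0_sg cd);
    case: odd => //=; rewrite ?expr0 ?expr1 ?mulr1 ?mul1r => /eqP; by rewrite ?ne11.
case: cU => UP; first exact: leq_count_parity_up parity.
by apply: (leq_count_parity uz UP (b := (c * d < 0))) => z /parity[].
Qed.
End Interlacing.

(** * Derivatives in the half-plane, and composition with a power of X + a *)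

Lemma sumr_seq_gt0 (F : numDomainType) (I : eqType) (r : seq I) (f : I -> F) :
  r != [::] -> (forall i, i \in r -> 0 < f i) -> 0 < \sum_(i <- r) f i.
Proof.
case: r => // x r _ f0; rewrite big_cons ltr_wpDr ?f0 ?mem_head //.
by rewrite big_seq sumr_ge0 // => y yr; rewrite ltW // f0 // inE yr orbT.
Qed.

(** Half-plane form of the Gauss-Lucas theorem: for z above the axis every 1 / (z - x) has negative
    imaginary part, so the logarithmic derivative is not zero. *)
Lemma lower_deriv (C : numClosedFieldType) (q : {poly C}) :
  (1 < size q)%N -> lower q -> lower q^`().
Proof.
move=> sq lq z rz; rewrite real_leNgt ?Creal_Im //; apply/negP => z0.
have qz : q.[z] != 0 by apply: contraL z0 => /lq /le_gtF ->.
have [r defq] := closed_field_poly_normal q.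
have c0 : lead_coef q != 0 by rewrite lead_coef_eq0 lower_neq0.
have rq x : x \in r -> root q x by move=> xr; rewrite defq rootZ // root_prod_XsubC.
have zr : z \notin r by apply: contra qz => /rq.
have r0 : r != [::].
  by apply: contraTneq sq => r0; rewrite defq size_scale // size_prod_XsubC r0.
move: rz; rewrite rootE defq derivZ hornerZ horner_deriv_prod_XsubC //.
rewrite mulrA -hornerZ -defq mulf_eq0 (negPf qz) /= => /eqP s0.
have : 0 < \sum_(x <- r) - 'Im (z - x)^-1.
  apply: sumr_seq_gt0 => // x xr; rewrite ImV_norm mulNr opprK raddfB /=.
  rewrite mulr_gt0 //; first by rewrite subr_gt0 (le_lt_trans _ z0) // lq // rq.
  rewrite exprn_gt0 // normr_gt0 invr_eq0 subr_eq0.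
  by apply: contraNneq zr => ->.
by rewrite sumrN -raddf_sum s0 raddf0 oppr0 ltxx.
Qed.

Lemma coef_mono_size (F : fieldType) (s : seq F) : (mono s)`_(size s) = 1.
Proof.
have := lead_coef_prod_XsubC (map -%R s) xpredT id.
by rewrite -mono_XsubC lead_coefE size_mono.
Qed.

Section SscMono.
Variable F : numFieldType.
Implicit Types (p q : {poly F}) (s : seq F).

Lemma mono_nseq n (a : F) : mono (nseq n a) = ('X + a%:P) ^+ n.
Proof. by rewrite /mono big_nseq iter_mulr_1. Qed.

(** The binomial coefficients of (X + a)^n turn every weight i! (n - i)! into n!, leaving only
    powers of a. *)
Lemma ssc_nseq n (a : F) q : (size q <= n.+1)%N -> a != 0 ->
  ssc n (mono (nseq n a)) q = (n`!%:R * a ^+ n) *: (q \Po (a^-1 *: 'X)).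
Proof.
move=> sq a0; apply/polyP => i; rewrite coef_ssc coefZ.
have -> : (q \Po (a^-1 *: 'X))`_i = a^-1 ^+ i * q`_i.
  have -> : q \Po (a^-1 *: 'X) = \poly_(j < size q) (q`_j * a^-1 ^+ j).
    by rewrite comp_polyE poly_def; apply: eq_bigr => j _; rewrite exprZn scalerA.
  rewrite coef_poly; case: ltnP => iq; first by rewrite mulrC.
  by rewrite nth_default // mulr0.
have -> : mono (nseq n a) = \poly_(j < n.+1) (a ^+ (n - j) *+ 'C(n, j)).
  rewrite mono_nseq addrC exprDn poly_def; apply: eq_bigr => j _.
  by rewrite -mul_polyC polyCMn polyC_exp mulrnAl.
rewrite coef_poly; case: ltnP => [|iq]; last first.
  by rewrite nth_default ?(leq_trans sq) ?mulr0.
rewrite ltnS => lin; rewrite -[_ *+ 'C(n, i)]mulr_natr -(bin_fact lin) !natrM.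
rewrite exprB ?unitfE // exprVn.
by move: (a ^+ n) (a ^+ i)^-1 ('C(n, i)%:R) (i`!%:R) ((n - i)`!%:R) => *; ring.
Qed.
End SscMono.

(** * Weyl-type inequalities for the roots of a composite *)

Section Weyl.
Variable R : rcfType.
Implicit Types (p q : {poly R}) (s : seq R).

Lemma horner_ssc_mono (a : R) s bs t : a != 0 -> size bs = (size s).+1 ->
  (ssc (size s).+1 (mono (a :: s)) (mono bs)).[t] =
  \sum_(b <- bs) (t + a * b) * (ssc (size s) (mono s) (mono (rem b bs))).[t].
Proof.
move=> a0 sb; rewrite mono_cons horner_ssc_XaddC ?size_mono // -sb polar_mono.
rewrite linear_sum horner_sum mulr_sumr; apply: eq_bigr => b _ /=.
by rewrite linearZ /= hornerZ; field.
Qed.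

Lemma ssc_mono_sign (e t : R) s bs : size bs = size s ->
  all (fun a => a != 0) s ->
  (forall a b, a \in s -> b \in bs -> 0 < e * (t + a * b)) ->
  0 < e ^+ size s * (ssc (size s) (mono s) (mono bs)).[t].
Proof.
elim: s bs => [|a s IHs] bs /=.
  move=> /size0nil -> _ _; rewrite ssc_nil hornerC /mono big_nil coef1.
  by rewrite mulr1.
move=> sb /andP[a0 s0] st; rewrite horner_ssc_mono // mulr_sumr.
have pos b : b \in bs ->
    0 < e ^+ (size s).+1 * ((t + a * b) * (ssc (size s) (mono s) (mono (rem b bs))).[t]).
  move=> bb; rewrite exprS mulrACA mulr_gt0 ?st ?mem_head //.
  apply: IHs => // [|x y xs yb]; first by rewrite size_rem // sb.
  by apply: st; rewrite ?inE ?xs ?orbT // (mem_rem yb).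
by apply: sumr_seq_gt0 pos; case: (bs) sb.
Qed.

Lemma real_rooted_deriv q : (1 < size q)%N -> real_rooted q -> real_rooted q^`().
Proof.
move=> sq rq; apply: lower_real_rooted; rewrite -deriv_map.
by apply: lower_deriv; [rewrite size_map_poly | exact: real_rooted_lower].
Qed.

Lemma size_real_rooted_split q : real_rooted q -> exists c s,
  [/\ c != 0, q = c *: mono s & size q = (size s).+1].
Proof.
case/real_rooted_split => c [s [c0 ->]]; exists c, s.
by rewrite size_scale // size_mono.
Qed.

Definition pos_seq s := all (fun a => 0 < a) s.

Lemma pos_seq_neq0 s : pos_seq s -> all (fun a => a != 0) s.
Proof. by apply: sub_all => a /lt0r_neq0. Qed.

Lemma pos_seq_mono c s : c != 0 ->
  (forall t, 0 <= t -> (c *: mono s).[t] != 0) -> pos_seq s.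
Proof.
move=> c0 h; apply/allP => a sa; rewrite ltNge; apply/negP => a0.
have /h/negP[] : 0 <= - a by rewrite oppr_ge0.
by rewrite -rootE rootZ // root_mono opprK.
Qed.

(** Real roots come from [real_rooted_ssc], their negativity from [ssc_mono_sign] at t >= 0, and the
    full degree from the nonzero top coefficient. *)
Lemma ssc_mono_split s bs : pos_seq s -> pos_seq bs -> size bs = size s ->
  exists c cs, [/\ c != 0, pos_seq cs, size cs = size s &
    ssc (size s) (mono s) (mono bs) = c *: mono cs].
Proof.
move=> sp bp sb.
have rb : real_rooted (mono bs).
  by rewrite -[mono bs]scale1r; exact: real_rooted_mono (oner_neq0 _).
have szb : (size (mono bs) <= (size s).+1)%N by rewrite size_mono sb.
have /size_real_rooted_split[c [cs [c0 def szc]]] := real_rooted_ssc sp rb szb.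
have pos : pos_seq cs.
  apply: (pos_seq_mono c0) => t t0; rewrite -def lt0r_neq0 //.
  have := @ssc_mono_sign 1 t s bs sb (pos_seq_neq0 sp).
  rewrite expr1n mul1r; apply => a b /(allP sp) a0 /(allP bp) b0.
  by rewrite mul1r ltr_wpDl // mulr_gt0.
exists c, cs; split=> //.
suff szn : size (ssc (size s) (mono s) (mono bs)) = (size s).+1.
  by have := szc; rewrite szn => -[].
apply/eqP; rewrite eqn_leq size_ssc ltnNge; apply/negP => /(nth_default 0)/eqP.
rewrite coef_ssc ltnSn coef_mono_size -sb coef_mono_size !mulr1 pnatr_eq0.
by rewrite muln_eq0 !eqn0Ngt !fact_gt0.
Qed.

Lemma ssc_ones n q : (size q <= n.+1)%N ->
  ssc n (mono (nseq n 1)) q = n`!%:R *: q.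
Proof.
move=> sq; rewrite ssc_nseq ?oner_neq0 // expr1n mulr1 invr1 scale1r.
by rewrite comp_polyXr.
Qed.

Lemma count_interlacing_compl (U : pred R) zs ws : size zs = (size ws).+1 ->
  (count (predC U) zs <= (count (predC U) ws).+1)%N -> (count U ws <= count U zs)%N.
Proof.
by move=> sz; have := count_predC U zs; have := count_predC U ws; lia.
Qed.

(** By [ssc_ones], a polynomial and its derivative are, up to constants, composites with powers of X
    + 1, so [ssc_wronskian] makes their roots interlace. Counting in the complement of [U] gives the
    bound. *)
Lemma deriv_mono_split bs n : pos_seq bs -> size bs = n.+1 ->
  exists c bs', [/\ c != 0, pos_seq bs', size bs' = n,
    (mono bs)^`() = c *: mono bs' &
    forall U, up_closed U \/ down_closed U -> (count U bs' <= count U bs)%N].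
Proof.
move=> bp sb; have szb : size (mono bs) = n.+2 by rewrite size_mono sb.
have rb : real_rooted (mono bs).
  by rewrite -[mono bs]scale1r; exact: real_rooted_mono (oner_neq0 _).
have rd : real_rooted (mono bs)^`() by apply: real_rooted_deriv; rewrite ?szb.
have /size_real_rooted_split[c [bs' [c0 def szd]]] := rd.
have sb' : size bs' = n.
  apply/eqP; rewrite -eqSS -szd eqn_leq -{1}[n.+1]/(n.+2.-1) -szb.
  rewrite -ltnS prednK ?szb // -{1}szb lt_size_deriv ?mono_neq0 //=.
  rewrite ltnNge; apply/negP => /(nth_default 0) /eqP.
  by rewrite coef_derivM -sb coef_mono_size mulr1 pnatr_eq0 sb.
exists c, bs'; split=> //.
  apply: (pos_seq_mono c0) => t t0; rewrite -def deriv_mono horner_sum.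
  rewrite lt0r_neq0 //; apply: sumr_seq_gt0 => [|b bb]; first by case: (bs) sb.
  rewrite /mono horner_prod big_seq prodr_gt0 // => a /mem_rem ab.
  by rewrite !hornerE ltr_wpDl // (allP bp).
move=> U cU; apply: count_interlacing_compl; first by rewrite sb sb'.
have f0 k : (k`!%:R : R) != 0 by rewrite pnatr_eq0 eqn0Ngt fact_gt0.
apply: (@interlacing_count _ n.+1`!%:R (n`!%:R * c) 1).
- exact: f0.
- by rewrite mulf_neq0.
- exact: ltr01.
- case: cU => cU; [right|left] => x y xy /=; apply: contra; exact: cU.
move=> t; rewrite mul1r -scalerA -def -!ssc_ones ?szb ?szd ?sb' //.
have := @ssc_wronskian R 1 (nseq n 1) (mono bs) t ltr01.
rewrite size_nseq; apply=> //; last by rewrite szb.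
by apply/allP => x /nseqP[-> _]; exact: ltr01.
Qed.

(** A flag for the direction, so that one induction serves both small and large roots. *)
Definition ltd (e : bool) (x y : R) := if e then x < y else y < x.

Lemma ltd_closed e y : up_closed (ltd e ^~ y) \/ down_closed (ltd e ^~ y).
Proof.
by case: e; [right|left] => x z xz; [exact: le_lt_trans|move/lt_le_trans; exact].
Qed.

(** A multiplicative analogue of Weyl's inequalities for eigenvalues. If an element of [s] lies
    beyond [a], remove it and differentiate the other polynomial: interlacing costs one root, which
    the removed element pays for. The roles of [s] and [bs] may be exchanged. *)
Lemma ssc_count_weyl (e : bool) (a b c : R) s bs cs : 0 < a -> 0 < b ->
  pos_seq s -> pos_seq bs -> size bs = size s -> c != 0 ->
  size cs = size s ->
  ssc (size s) (mono s) (mono bs) = c *: mono cs ->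
  (count (ltd e ^~ (a * b)%R) cs <= count (ltd e ^~ a) s + count (ltd e ^~ b) bs)%N.
Proof.
move=> a0 b0; move sn : (size s) => n.
elim: n s bs c cs a b a0 b0 sn => [|n IHn] s bs c cs a b a0 b0 sn sp bp sb c0 sc def.
  by rewrite (size0nil sc).
have step s1 bs1 (a1 b1 : R) : 0 < a1 -> 0 < b1 -> a1 * b1 = a * b ->
    size s1 = n.+1 -> size bs1 = n.+1 -> pos_seq s1 -> pos_seq bs1 ->
    ssc n.+1 (mono s1) (mono bs1) = c *: mono cs -> has (ltd e ^~ a1) s1 ->
    (count (ltd e ^~ (a * b)%R) cs <=
     count (ltd e ^~ a1) s1 + count (ltd e ^~ b1) bs1)%N.
  move=> a10 b10 <- s1n bs1n s1p bs1p def1 /hasP[x xs xa].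
  have perms := perm_to_rem xs.
  have s'p := s1p; rewrite /pos_seq (perm_all _ perms) /= in s'p.
  case/andP: s'p => x0 s'p.
  have s'n : size (rem x s1) = n by rewrite size_rem // s1n.
  have [k [bs' [k0 bs'p bs'n dbs cbs]]] := deriv_mono_split bs1p bs1n.
  have [d [ws [d0 wsp wsn defw]]] := ssc_mono_split s'p bs'p (etrans bs'n (esym s'n)).
  rewrite s'n in defw wsn.
  have le1 : (count (ltd e ^~ (a1 * b1)%R) cs <= (count (ltd e ^~ (a1 * b1)%R) ws).+1)%N.
    apply: (@interlacing_count _ c (k * d) 1) => //; first by rewrite mulf_neq0.
      exact: ltd_closed.
    move=> t; have := @ssc_wronskian R x (rem x s1) (mono bs1) t x0 s'p.
    rewrite s'n size_mono bs1n -(perm_mono perms) def1 dbs linearZ /= defw scalerA mul1r.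
    apply=> //; rewrite -[mono bs1]scale1r; exact: real_rooted_mono (oner_neq0 _).
  apply: leq_trans le1 _; rewrite (permP perms) /= xa add1n addSn ltnS.
  apply: leq_trans (leq_add (leqnn _) (cbs _ (ltd_closed e b1))).
  exact: (IHn _ _ d ws a1 b1).
have [ha|/hasPn ha] := boolP (has (ltd e ^~ a) s); first exact: step.
have [hb|/hasPn hb] := boolP (has (ltd e ^~ b) bs).
  by rewrite addnC; apply: step => //; rewrite 1?mulrC // sscC.
(* No element lies beyond [a] or [b], so for a root -x with x beyond a b all the u v - x would have
   one sign, against [ssc_mono_sign]. *)
suff /hasPn no : ~~ has (ltd e ^~ (a * b)%R) cs.
  by rewrite (eq_in_count (a2 := pred0)) ?count_pred0 // => x /no/negPf.
apply/hasP => -[x xc xab].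
have : (c *: mono cs).[- x] = 0 by rewrite hornerZ (rootP _) ?mulr0 // root_mono opprK.
rewrite -def -sn => z0.
have := @ssc_mono_sign ((-1) ^+ ~~ e) (- x) s bs (etrans sb (esym sn)) (pos_seq_neq0 sp).
rewrite z0 mulr0 ltxx => h; suff: false by []; apply: h => u v us vb.
have u0 := allP sp u us; have v0 := allP bp v vb.
have := ha u us; have := hb v vb; case: (e) xab => /= xab; rewrite -!leNgt => bv au.
  rewrite expr0 mul1r addrC subr_gt0 (lt_le_trans xab) //.
  by rewrite ler_pM // ltW.
rewrite expr1 mulN1r opprD opprK subr_gt0 (le_lt_trans _ xab) //.
by rewrite ler_pM // ltW.
Qed.
End Weyl.

(** * Multiplicities under polar derivatives *)

Section Multiplicity.
Variable R : rcfType.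
Implicit Types (p q : {poly R}) (s : seq R).

Lemma mup_factor q x : q != 0 ->
  exists2 p, ~~ root p x & q = ('X - x%:P) ^+ mup x q * p.
Proof.
move=> q0; have [m [p]] := multiplicity_XsubC q x; rewrite q0 /= => px defq.
by exists p; rewrite // {2}defq mupMr // mup_XsubCX eqxx mulrC.
Qed.

Lemma mup_mulX m p x : ~~ root p x -> mup x (('X - x%:P) ^+ m * p) = m.
Proof. by move=> px; rewrite mulrC mupMr // mup_XsubCX eqxx. Qed.

Lemma mup_lt_size q x : q != 0 -> (mup x q < size q)%N.
Proof.
move=> q0; have [p px ->] := mup_factor x q0; rewrite mup_mulX //.
have p0 : p != 0 by apply: contraNneq px => ->; rewrite root0.
rewrite size_monicM ?monic_exp ?monicXsubC // size_exp_XsubC addSn /=.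
by rewrite -[X in (X < _)%N]addn0 ltn_add2l size_poly_gt0.
Qed.

Lemma deriv_XsubCX_mul m p x :
  (('X - x%:P) ^+ m.+1 * p)^`() =
  ('X - x%:P) ^+ m * (m.+1%:R *: p + ('X - x%:P) * p^`()).
Proof.
rewrite derivM deriv_exp derivXsubC mul1r /= exprS -scaler_nat -!mul_polyC; ring.
Qed.

Lemma polar_XsubCX_mul n m p t : polar n t (('X - t%:P) ^+ m * p) =
  ('X - t%:P) ^+ m * ((n%:R - m%:R) *: p - ('X - t%:P) * p^`()).
Proof.
rewrite /polar; case: m => [|m]; first by rewrite !expr0 !mul1r subr0.
by rewrite deriv_XsubCX_mul exprS -!mul_polyC polyCB; ring.
Qed.

(** With q = (X - t)^m p, the new cofactor takes the value (n - m) p(t) at t, so the multiplicity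
    stays m unless m = n, where the degree gives the bound. *)
Lemma mup_polar_ge n t q : (size q <= n.+1)%N -> polar n t q != 0 ->
  (mup t (polar n t q) <= mup t q)%N.
Proof.
case: n => [|n] sq p0.
  by move: p0; rewrite /polar (size1_polyC sq) derivC scale0r mulr0 subr0 eqxx.
have q0 : q != 0 by apply: contraNneq p0 => ->; rewrite /polar scaler0 derivC mulr0 subr0.
have [p pt defq] := mup_factor t q0; move: (mup t q) defq (mup_lt_size t q0) => m defq ml.
have polE := polar_XsubCX_mul n.+1 m p t; rewrite -defq in polE.
have [mn|mn] := eqVneq m n.+1.
  rewrite mn (leq_trans (ltnW (mup_lt_size t p0))) //; exact: size_polar.
rewrite polE mup_mulX // rootE !hornerE subrr mul0r subr0 mulf_neq0 //.
by rewrite subr_eq0 eqr_nat eq_sym.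
Qed.

Lemma polar_eq0_mup n t q : q != 0 -> polar n.+1 t q = 0 -> (n.+1 <= mup t q)%N.
Proof.
move=> q0; have [p pt defq] := mup_factor t q0.
move: (mup t q) defq => m defq.
rewrite defq polar_XsubCX_mul => /eqP; rewrite mulf_eq0 expf_eq0 polyXsubC_eq0 andbF /=.
move=> /eqP/(congr1 (horner^~ t)) /eqP.
rewrite !hornerE subrr mul0r subr0 mulf_eq0 -[p.[t] == 0]/(root p t) (negPf pt) orbF.
by rewrite subr_eq0 eqr_nat => /eqP ->.
Qed.

(** Away from the pole the term (X - t) q' has the lowest order at x, so multiplicities drop as for
    the ordinary derivative. *)
Lemma mup_polar_neq n t x q : q != 0 -> x != t -> root q x ->
  mup x q = (mup x (polar n t q)).+1.
Proof.
move=> q0 xt qx; have [p px defq] := mup_factor x q0.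
have : (0 < mup x q)%N by rewrite mup_geq // dvdp_XsubCl.
move: (mup x q) defq => [//|m] defq _.
have -> : polar n t q = ('X - x%:P) ^+ m *
    (n%:R *: (('X - x%:P) * p) - ('X - t%:P) * (m.+1%:R *: p + ('X - x%:P) * p^`())).
  by rewrite /polar defq deriv_XsubCX_mul exprS -!mul_polyC; ring.
rewrite mup_mulX // rootE !(hornerD, hornerN, hornerZ, hornerM, hornerX, hornerC).
rewrite subrr !mul0r mulr0 sub0r addr0.
by rewrite oppr_eq0 !mulf_neq0 // ?subr_eq0 // pnatr_eq0.
Qed.

Lemma horner_deriv2_prod_XsubC (r : seq R) z : z \notin r ->
  (\prod_(x <- r) ('X - x%:P))^`()^`().[z] =
  (\prod_(x <- r) ('X - x%:P)).[z] *
    ((\sum_(x <- r) (z - x)^-1) ^+ 2 - \sum_(x <- r) (z - x)^-1 ^+ 2).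
Proof.
elim: r => [|a r IHr]; first by rewrite !big_nil !derivC hornerC expr0n subr0 mulr0.
rewrite inE negb_or => /andP[za zr].
have za0 : z - a != 0 by rewrite subr_eq0.
have d1 := horner_deriv_prod_XsubC zr.
rewrite !big_cons derivM derivXsubC mul1r derivD derivM derivXsubC mul1r.
by rewrite !hornerD !hornerM IHr // d1 hornerXsubC; field.
Qed.

(* Equality case of Laguerre's inequality, with u_x and v as in [polar_root_eq0]. *)
Lemma polar_double_root n q t z : (size q <= n.+1)%N -> real_rooted q ->
  z != t -> ~~ root q z -> root (polar n t q) z -> root (polar n t q)^`() z ->
  polar n t q = 0.
Proof.
case: n => [|n] sq rq zt qz rz dz.
  by rewrite /polar scale0r (size1_polyC sq) derivC mulr0 subr0.
have [c [s [c0 defs ss]]] := size_real_rooted_split rq.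
rewrite mono_XsubC in defs; rewrite -(size_map -%R s) in ss.
move: (map _ s) defs ss => r defq sr {s}.
have {}sr : (size r <= n.+1)%N by rewrite -ltnS -sr.
have zr : z \notin r.
  by apply: contra qz => zr; rewrite defq rootZ // root_prod_XsubC.
have zt0 : z - t != 0 by rewrite subr_eq0.
pose u x := (z - x)^-1; pose v := (z - t)^-1.
have v0 : v != 0 by rewrite invr_eq0.
have dq : q^`().[z] = q.[z] * \sum_(x <- r) u x.
  by rewrite defq derivZ !hornerZ horner_deriv_prod_XsubC // mulrA.
have ddq : q^`()^`().[z] = q.[z] * ((\sum_(x <- r) u x) ^+ 2 - \sum_(x <- r) u x ^+ 2).
  by rewrite defq !derivZ !hornerZ horner_deriv2_prod_XsubC // mulrA.
rewrite rootE in qz.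
have su : \sum_(x <- r) u x = n.+1%:R * v.
  move: rz; rewrite rootE /polar !hornerE dq subr_eq0 => /eqP e.
  apply: (mulfI qz); apply: (mulfI zt0); rewrite -[RHS]/((z - t) * (q.[z] * _)).
  by rewrite -{}e /v; field.
have su2 : \sum_(x <- r) u x ^+ 2 = n.+1%:R * v ^+ 2.
  move: dz; rewrite rootE deriv_polar /polar.
  rewrite !(hornerD, hornerN, hornerZ, hornerM, hornerX, hornerC).
  rewrite dq ddq su subr_eq0 => /eqP e.
  have {}e : n%:R * (n.+1%:R * v) =
      (z - t) * ((n.+1%:R * v) ^+ 2 - \sum_(x <- r) u x ^+ 2).
    by apply: (mulfI qz); move: e; rewrite /u => e; rewrite mulrCA e; ring.
  have {}e : n%:R * (n.+1%:R * v) * v = (n.+1%:R * v) ^+ 2 - \sum_(x <- r) u x ^+ 2.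
    by rewrite e /v; field.
  rewrite -!natr1 in e.
  have -> : \sum_(x <- r) u x ^+ 2 = ((n%:R + 1) * v) ^+ 2 - n%:R * ((n%:R + 1) * v) * v.
    by rewrite e; ring.
  by rewrite -natr1; ring.
have : \sum_(x <- r) (u x - v) ^+ 2 + (n.+1 - size r)%:R * v ^+ 2 = 0.
  under eq_bigr do rewrite sqrrB.
  rewrite big_split sumrB /= su2 sumrMnl -mulr_suml su.
  rewrite big_const_seq count_predT iter_addr_0 natrB //.
  by rewrite -[_ *+ size r]mulr_natl; ring.
move/eqP; rewrite paddr_eq0; last 2 first.
- by apply: sumr_ge0 => x _; exact: sqr_ge0.
- by rewrite mulr_ge0 ?sqr_ge0.
rewrite mulf_eq0 expf_eq0 (negPf v0) orbF pnatr_eq0.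
rewrite psumr_eq0; last by move=> x _; exact: sqr_ge0.
case/andP => /allP h; rewrite subn_eq0 => sr'.
have rt : r = nseq n.+1 t.
  rewrite -(anti_leq (introT andP (conj sr sr'))); apply/all_pred1P/allP => x xr /=.
  have /implyP/(_ isT) := h _ xr; rewrite expf_eq0 subr_eq0 /=.
  move=> /eqP /invr_inj /eqP.
  by rewrite (inj_eq (addrI z)) eqr_opp => /eqP ->.
by rewrite defq rt big_nseq iter_mulr_1 polar_XsubCX.
Qed.
End Multiplicity.

(** * Multiple roots of a composite *)

Section Classification.
Variable R : rcfType.
Implicit Types (p q : {poly R}) (s : seq R).

(* By [horner_ssc_XaddC] the two hypotheses say that the composite of the polar
   derivatives at the points [g / a], [a \in s], annihilates [q]. *)
Lemma polar_chain s q (g : R) : pos_seq s -> real_rooted q ->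
  (size q <= (size s).+2)%N ->
  (ssc (size s) (mono s) q^`()).[g] = 0 ->
  (ssc (size s) (mono s) (polar (size s).+1 0 q)).[g] = 0 ->
  exists x, ((size s).+2 <= mup x q + count (fun a => g / a == x) s)%N.
Proof.
elim: s q => [|a s IHs] q /=.
  move=> _ rq sq; rewrite !ssc_nil !hornerC coef_derivM mul1r => q1.
  rewrite /polar coefB coefZ subr0 coefXM subr0 mul1r => q0.
  case/eqP: (real_rooted_neq0 rq); apply/polyP => -[|[|i]]; rewrite coef0 //.
  by rewrite nth_default // (leq_trans sq).
case/andP=> a0 sp rq sq; have an0 := lt0r_neq0 a0.
rewrite mono_cons !horner_ssc_XaddC ?size_mono // polarC -deriv_polar.
set t := g / a; set q1 := polar _ t q.
move=> /eqP; rewrite mulf_eq0 (negPf an0) => /eqP h1.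
move=> /eqP; rewrite mulf_eq0 (negPf an0) => /eqP h2.
have [q10|q10] := eqVneq q1 0.
  exists t; rewrite eqxx.
  by have := polar_eq0_mup (real_rooted_neq0 rq) q10; lia.
have rq1 : real_rooted q1 by apply: real_rooted_polar.
have [x hx] := IHs q1 sp rq1 (size_polar _ sq) h1 h2.
(* At the pole, the multiplicity in [q] is at least that in [q1], and the entry [a] adds one to the
   count. *)
exists x; case: (eqVneq t x) hx => [<-|tx] hx.
  have h : (mup t q1 <= mup t q)%N := mup_polar_ge sq q10.
  by rewrite add1n addnS ltnS (leq_trans hx) // leq_add2r.
(* Away from the pole, the bound leaves multiplicity at least 2 in [q1]. By [polar_double_root] such
   a point is already a root of [q], with multiplicity one higher. *)
have m2 : (1 < mup x q1)%N.
  by rewrite -(ltn_add2r (size s)) add1n (leq_trans hx) // leq_add2l count_size.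
have [p _ defq1] := mup_factor x q10.
have [r1 dr1] : root q1 x /\ root q1^`() x.
  rewrite defq1; case: (mup x q1) m2 => [|[|m]] // _.
  by rewrite deriv_XsubCX_mul !exprS -!mulrA !rootM !root_XsubC eqxx.
suff rx : root q x.
  by rewrite (@mup_polar_neq _ (size s).+2 t x q (real_rooted_neq0 rq) _ rx) // eq_sym.
apply: contraNT q10 => qx; apply/eqP.
by apply: polar_double_root qx r1 dr1 => //; rewrite eq_sym.
Qed.

(** At a multiple root g the composite and its derivative vanish, so [ssc_wronskian] forces the
    composite with one factor removed to vanish too. [polar_chain] then yields a point x, and b =
    -x, a = g / x are the required values. *)
Lemma multiple_root_pair s bs (g : R) n : pos_seq s -> pos_seq bs ->
  size s = n -> size bs = n -> g != 0 ->
  (1 < mup g (ssc n (mono s) (mono bs)))%N ->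
  exists a b, [/\ a \in s, b \in bs, g = - (a * b) &
    (n < count_mem a s + count_mem b bs)%N].
Proof.
move=> sp bp sn bn g0; case: s n sp sn bn => [|a s] [|n] //.
  move=> _ _ /size0nil->; rewrite ssc_nil => h.
  have c0 : ((mono [::])`_0)%:P != 0 :> {poly R}.
    by rewrite /mono big_nil coef1 polyC_eq0 oner_eq0.
  by have := mup_lt_size g c0; rewrite ltnNge (leq_trans (size_polyC_leq1 _) (ltnW h)).
move=> sp [sn] bn m2; move: (sp) => /andP[a0 s'p].
have rb : real_rooted (mono bs).
  by rewrite -[mono bs]scale1r; exact: real_rooted_mono (oner_neq0 _).
have szb : (size (mono bs) <= (size s).+2)%N by rewrite size_mono bn sn.
set f := ssc _ _ _ in m2.
have f0 : f != 0.
  have [c [cs [c0 _ _]]] := @ssc_mono_split _ (a :: s) bs sp bp ltac:(by rewrite bn -sn).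
  by rewrite /= sn -/f => ->; rewrite scaler_eq0 negb_or c0 mono_neq0.
have [p _ deff] := mup_factor g f0.
case: (mup g f) m2 deff => [|[|m]] // _ deff.
have fg : f.[g] = 0 by rewrite deff exprS -mulrA hornerM hornerXsubC subrr mul0r.
have dfg : f^`().[g] = 0.
  by rewrite deff deriv_XsubCX_mul exprS -mulrA hornerM hornerXsubC subrr mul0r.
have g2 : (ssc n (mono s) (mono bs)^`()).[g] = 0.
  apply/eqP; rewrite -sqrf_eq0 eq_le sqr_ge0 andbT.
  have := ssc_wronskian g a0 s'p szb rb; rewrite sn -/f /wronskian.
  by rewrite hornerD hornerN !hornerM fg dfg !mul0r subr0.
have h2 : (ssc n (mono s) (polar n.+1 0 (mono bs))).[g] = 0.
  move: fg; rewrite /f mono_cons ssc_XaddC ?size_mono ?sn // hornerD hornerM g2.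
  rewrite mulr0 add0r hornerZ /polar subr0 => /eqP.
  by rewrite mulf_eq0 (gt_eqF a0) => /eqP.
have [x hx] : exists x, (n.+2 <= mup x (mono bs) + count (fun a => g / a == x) s)%N.
  by have := @polar_chain s (mono bs) g s'p rb szb; rewrite sn; apply.
rewrite mup_mono in hx.
have cb : (count_mem (- x) bs <= n.+1)%N by rewrite -bn count_size.
have cs : (count (fun a => g / a == x) s <= n)%N by rewrite -sn count_size.
(* Neither count alone reaches n + 2, so both are positive. *)
have /hasP[c cs' /eqP gc] : has (fun a => g / a == x) s.
  by rewrite has_count -(ltn_add2l (count_mem (- x) bs)) addn0 (leq_ltn_trans cb).
have c0 : c != 0 by rewrite lt0r_neq0 // (allP s'p).
have eqc : count (fun a => g / a == x) s = count_mem c s.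
  apply: eq_count => d /=; rewrite -gc (inj_eq (mulfI g0)) (inj_eq invr_inj).
  by [].
exists c, (- x); split.
- by rewrite inE cs' orbT.
- rewrite -has_pred1 has_count -(ltn_add2r (count (fun a => g / a == x) s)) add0n.
  by rewrite (leq_ltn_trans cs) // ltnW.
- by rewrite -gc mulrN opprK mulrC mulfVK.
by rewrite eqc in hx; rewrite (leq_trans hx) //= addnC leq_add2r leq_addl.
Qed.

(* [l] does not depend on [p]: the induction step combines two cofactors [p]. *)
Lemma ssc_mup_exact (a x : R) m s j : a != 0 -> x != 0 -> a \notin s ->
  exists2 l : R, l != 0 & forall p,
    (size (('X - x%:P) ^+ (size s + j) * p)%R <= (size s + m).+1)%N ->
  exists2 r, ssc (size s + m) (mono (s ++ nseq m a)) (('X - x%:P) ^+ (size s + j) * p) =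
      ('X - (a * x)%:P) ^+ j * r & r.[a * x] = l * p.[x].
Proof.
move=> a0 x0; elim: s => [|b s IHs] /=.
  exists (m`!%:R * a ^+ m * a^-1 ^+ j) => [|p sp].
    by rewrite !mulf_neq0 ?expf_neq0 ?invr_eq0 // pnatr_eq0 eqn0Ngt fact_gt0.
  exists ((m`!%:R * a ^+ m * a^-1 ^+ j) *: (p \Po (a^-1 *: 'X))); last first.
    by rewrite hornerZ horner_comp hornerZ hornerX mulKf.
  rewrite !add0n ssc_nseq // comp_polyM rmorphXn /= comp_polyB comp_polyX comp_polyC.
  have -> : a^-1 *: 'X - x%:P = a^-1 *: ('X - (a * x)%:P).
    by rewrite scalerBr -mul_polyC -[in RHS]mul_polyC -polyCM mulKf // mul_polyC.
  by rewrite exprZn -!scalerAl -scalerAr !scalerA.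
rewrite inE negb_or => /andP[ab /IHs[l l0 IH]].
pose k := (size s + j)%N.
(* At a x, the part X r1 contributes l a x (k + 1) p(x) and the part b r2 contributes -l b x (k + 1)
   p(x). *)
exists (l * (k.+1%:R * x * (a - b))) => [|p sp].
  by rewrite !mulf_neq0 ?pnatr_eq0 // subr_eq0.
set q := _ * p in sp *.
pose p1 := k.+1%:R *: p + ('X - x%:P) * p^`().
pose p2 := (size s + m).+1%:R *: (('X - x%:P) * p) - 'X * p1.
have dq : q^`() = ('X - x%:P) ^+ k * p1 by rewrite /q addSn deriv_XsubCX_mul.
have pq : (size s + m).+1%:R *: q - 'X * q^`() = ('X - x%:P) ^+ k * p2.
  by rewrite dq /q /p2 addSn exprS -!mul_polyC; ring.
have [r1 e1 v1] : exists2 r, ssc (size s + m) (mono (s ++ nseq m a)) q^`() =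
    ('X - (a * x)%:P) ^+ j * r & r.[a * x] = l * p1.[x].
  rewrite dq; apply: IH; rewrite -dq.
  have [->|q0] := eqVneq q 0; first by rewrite derivC size_poly0.
  by rewrite -ltnS (leq_trans (lt_size_deriv q0)).
have [r2 e2 v2] : exists2 r, ssc (size s + m) (mono (s ++ nseq m a))
      ((size s + m).+1%:R *: q - 'X * q^`()) =
    ('X - (a * x)%:P) ^+ j * r & r.[a * x] = l * p2.[x].
  rewrite pq; apply: IH; rewrite -pq.
  by have := @size_polar _ _ 0 q sp; rewrite /polar subr0.
exists ('X * r1 + b *: r2).
  rewrite addSn mono_cons ssc_XaddC ?e1 ?e2 -?mul_polyC; first by ring.
  by rewrite size_mono size_cat size_nseq.
rewrite !(hornerD, hornerM, hornerX, hornerZ) v1 v2 /p2 /p1.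
rewrite !(hornerD, hornerN, hornerM, hornerX, hornerZ, hornerC) subrr.
by move: (k.+1%:R : R) ((size s + m).+1%:R : R) => *; ring.
Qed.

(** [ssc_mup_exact] applies with s' the entries of [s] other than [a]: the last hypothesis says that
    the multiplicity of [b] is at least the size of s', and the excess j is the multiplicity of the
    root -a b. *)
Lemma count_ssc_pair s bs cs (a b c : R) n : pos_seq s -> pos_seq bs ->
  size s = n -> size bs = n -> a \in s -> b \in bs ->
  c != 0 -> ssc n (mono s) (mono bs) = c *: mono cs ->
  (n <= count_mem a s + count_mem b bs)%N ->
  (count_mem (a * b)%R cs + n = count_mem a s + count_mem b bs)%N.
Proof.
move=> sp bp sn bn sa bb c0 def le_n.
have a0 := lt0r_neq0 (allP sp a sa); have b0 := lt0r_neq0 (allP bp b bb).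
have split_mult (x : R) r : perm_eq r (filter (predC1 x) r ++ nseq (count_mem x r) x).
  have <- : filter (predC (predC1 x)) r = nseq (count_mem x r) x.
    rewrite -size_filter (eq_filter (a2 := pred1 x)) => [|y]; last by rewrite /= negbK.
    exact/all_pred1P/filter_all.
  by rewrite perm_sym; exact/permPl/perm_filterC.
have ps := split_mult a s; have pb := split_mult b bs.
set m := count_mem a s in ps le_n *; set k := count_mem b bs in pb le_n *.
set s' := filter _ _ in ps; set bs' := filter _ _ in pb.
have as' : a \notin s' by rewrite mem_filter /= eqxx.
have bbs' : b \notin bs' by rewrite mem_filter /= eqxx.
have sz : (size s' + m)%N = n by rewrite -sn (perm_size ps) size_cat size_nseq.
have hk : (size s' <= k)%N by rewrite -(leq_add2l m) addnC sz.
have kE : k = (size s' + (k - size s'))%N by rewrite subnKC.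
have defbs : mono bs = ('X - (- b)%:P) ^+ (size s' + (k - size s')) * mono bs'.
  by rewrite -kE polyCN opprK -mono_nseq -mono_cat (perm_mono pb)
    -(perm_mono (permEl (perm_catC _ _))).
have bN0 : - b != 0 by rewrite oppr_eq0.
have [l l0 H] := @ssc_mup_exact a (- b) m s' (k - size s') a0 bN0 as'.
have szb : (size (('X - (- b)%:P) ^+ (size s' + (k - size s')) * mono bs')%R <=
  (size s' + m).+1)%N.
  by rewrite -defbs size_mono bn sz.
have [r e v] := H (mono bs') szb.
have rab : ~~ root r (a * - b).
  by rewrite rootE v mulf_neq0 // -rootE root_mono opprK.
have : mup (a * - b) (ssc n (mono s) (mono bs)) = (k - size s')%N.
  by rewrite (perm_mono ps) defbs -sz e mup_mulX.
rewrite def -mul_polyC mupMr ?rootC // mup_mono mulrN opprK => ->.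
by rewrite -sz addnA (subnK hk) addnC.
Qed.
End Classification.

(** * Ordered partitions encoded by their interior positions *)

Section Blocks.
Local Open Scope nat_scope.
Implicit Types s t : seq nat.

(* [inner s k] says that the k-th and (k+1)-st roots, counted with multiplicity,
   of a polynomial with multiplicity vector [s] coincide. *)
Fixpoint blocks acc s : seq (nat * nat) :=
  if s is m :: s' then (acc, acc + m) :: blocks (acc + m) s' else [::].

Definition inner s k := has (fun b => b.1 < k < b.2) (blocks 0 s).

(** Blocks of lengths m and q with m + q > n yield in the composite the block from [b.1 + d.1] to
    [b.2 + d.2 - n], of length m + q - n. Adding [n] to [k] avoids truncated subtraction. *)
Definition inner_comp n s t k :=
  has (fun b => has (fun d => (b.1 + d.1 < k) && (k + n < b.2 + d.2)) (blocks 0 t))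
    (blocks 0 s).

Lemma blocks_gt acc s k : has (fun b => b.1 < k < b.2) (blocks acc s) -> acc < k.
Proof.
elim: s acc => //= m s IHs acc /orP[/andP[]//|/IHs].
by apply: leq_ltn_trans; exact: leq_addr.
Qed.

(** If the first parts differ, the end of the shorter first block is interior to the longer one but
    not interior in its own sequence. If they agree, the tails are compared from the new offset. *)
Lemma inner_inj n s t : is_ordered_partition n s -> is_ordered_partition n t ->
  (forall k, k < n -> inner s k = inner t k) -> s = t.
Proof.
move=> /andP[s0 /eqP sn] /andP[t0 /eqP tn] H.
suff main acc : (forall k, k < acc + n -> has (fun b => b.1 < k < b.2) (blocks acc s) =
  has (fun b => b.1 < k < b.2) (blocks acc t)) -> s = t by exact: (main 0).
elim: s t acc n s0 t0 sn tn {H} => [|m s IHs] [|m' t] //= acc n.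
- by move=> _ /andP[]; lia.
- by move=> /andP[]; lia.
move=> /andP[m0 s0] /andP[m'0 t0] sn tn H.
have aux k x r : k <= acc + x ->
    has (fun b => b.1 < k < b.2) (blocks (acc + x) r) = false.
  by move=> h; apply/negP => /blocks_gt; rewrite ltnNge h.
case: (ltngtP m m') => mm.
- have := H (acc + m) ltac:(lia); rewrite (aux _ _ _ (leqnn _)) ltnn andbF.
  by rewrite ltn_add2l mm (_ : acc < acc + m) //; lia.
- have := H (acc + m') ltac:(lia); rewrite (aux _ _ t (leqnn _)) ltnn andbF.
  by rewrite ltn_add2l mm (_ : acc < acc + m') //; lia.
rewrite -{}mm in tn H *; congr cons.
apply: (IHs t (acc + m) (n - m)) => //; try lia.
move=> k kn; have [km|km] := leqP k (acc + m); first by rewrite !aux.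
have := H k ltac:(lia).
by rewrite (leq_gtF (ltnW km)) andbF.
Qed.
End Blocks.

(** * Multiplicity vectors and root counts *)

Section MultSeq.
Variable R : rcfType.
Implicit Types (s rs zs : seq R).

(** Generalised for induction over [rs]: the accumulator starts from the elements of [zs] below all
    of [rs], those of the blocks already passed. *)
Lemma blocks_count rs zs : sorted <%R rs ->
  (forall z, z \in zs -> (z \in rs) || all (fun x => z < x) rs) ->
  blocks (count (fun z => all (fun x => z < x) rs) zs) [seq count_mem x zs | x <- rs] =
  [seq (count (fun z => z < x)%R zs, count (fun z => z <= x)%R zs) | x <- rs].
Proof.
elim: rs => //= x rs IHrs srt cov.
have xrs : all (fun y => x < y) rs := order_path_min lt_trans srt.
have -> : count (fun z => (z < x) && all (fun y => z < y) rs) zs =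
    count (fun z => z < x)%R zs.
  apply: eq_count => z; case: ltP => //= zx.
  by apply: sub_all xrs => y; exact: lt_trans.
rewrite -count_le_lt; congr cons; rewrite -IHrs ?(path_sorted srt) //.
  congr blocks; apply: eq_in_count => z /cov; rewrite inE.
  case: (ltgtP z x) => //= zx; last by rewrite zx xrs.
    move=> _; apply/esym; apply: sub_all xrs => y; exact: lt_trans.
  rewrite orbF => zrs; apply/esym/negbTE/negP => /allP/(_ _ zrs).
  by rewrite ltxx.
move=> z /cov; rewrite inE => /orP[/orP[/eqP->|->]|/andP[_ ->]] //; last first.
  by rewrite orbT.
by rewrite xrs orbT.
Qed.

Lemma mult_seq_mono (c : R) s : c != 0 ->
  mult_seq (c *: mono s) = [seq count_mem (- x) s | x <- rootsR (c *: mono s)].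
Proof.
move=> c0; apply: eq_map => x.
by rewrite -mul_polyC mupMr ?rootC // mup_mono.
Qed.

Lemma mem_rootsR_mono (c x : R) s : c != 0 ->
  (x \in rootsR (c *: mono s)) = (- x \in s).
Proof.
move=> c0; have p0 : c *: mono s != 0 by rewrite scaler_eq0 negb_or c0 mono_neq0.
by rewrite -(roots_on_rootsR p0) inE andTb rootZ // root_mono.
Qed.

(** [s] holds opposites of roots, so the roots before x correspond to the elements greater than
    -x. *)
Lemma blocks_mult_seq (c : R) s : c != 0 ->
  blocks 0 (mult_seq (c *: mono s)) =
  [seq (count (fun a => - x < a)%R s, count (fun a => - x <= a)%R s) |
     x <- rootsR (c *: mono s)].
Proof.
move=> c0; set rs := rootsR _.
have memrs x : (x \in rs) = (- x \in s) by exact: mem_rootsR_mono.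
have memN z : (z \in map -%R s) = (- z \in s).
  by rewrite -{1}[z]opprK mem_map //; exact: oppr_inj.
have := @blocks_count rs (map -%R s) (sorted_roots _ _ _) _.
rewrite (eq_in_count (a2 := pred0)) ?count_pred0 => [|z]; last first.
  by rewrite memN -memrs => zr; apply/negbTE/negP => /allP/(_ _ zr); rewrite ltxx.
have -> : [seq (count (fun z => z < x)%R (map -%R s),
    count (fun z => z <= x)%R (map -%R s)) | x <- rs] =
  [seq (count (fun a => - x < a)%R s, count (fun a => - x <= a)%R s) | x <- rs].
  apply: eq_map => x; rewrite !count_map; congr (_, _); apply: eq_count => a /=.
    by rewrite ltrNl.
  by rewrite lerNl.
move=> <- => [|z]; last by rewrite memN -memrs => ->.
rewrite mult_seq_mono //; congr blocks; apply: eq_map => x /=.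
rewrite count_map; apply: eq_count => a /=.
by rewrite eqr_oppLR.
Qed.

Lemma inner_mult_seqP (c : R) s k : c != 0 ->
  reflect (exists2 a, a \in s &
     (count (fun y => a < y)%R s < k < count (fun y => a <= y)%R s)%N)
    (inner (mult_seq (c *: mono s)) k).
Proof.
move=> c0; rewrite /inner blocks_mult_seq // has_map.
apply: (iffP hasP) => [[x xr h]|[a sa h]].
  by exists (- x) => //; rewrite -(mem_rootsR_mono _ _ c0).
by exists (- a); rewrite ?mem_rootsR_mono //= opprK.
Qed.

Lemma inner_comp_mult_seqP n (c d : R) s bs k : c != 0 -> d != 0 ->
  reflect (exists a b, [/\ a \in s, b \in bs,
     (count (fun y => a < y)%R s + count (fun y => b < y)%R bs < k)%N &
     (k + n < count (fun y => a <= y)%R s + count (fun y => b <= y)%R bs)%N])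
    (inner_comp n (mult_seq (c *: mono s)) (mult_seq (d *: mono bs)) k).
Proof.
move=> c0 d0; rewrite /inner_comp !blocks_mult_seq // has_map.
apply: (iffP hasP) => [[x xr]|[a [b [sa bb h1 h2]]]].
  rewrite /= has_map => /hasP[y yr /= /andP[h1 h2]]; exists (- x), (- y).
  by rewrite -(mem_rootsR_mono _ _ c0) -(mem_rootsR_mono _ _ d0).
exists (- a); rewrite ?mem_rootsR_mono ?opprK //= has_map; apply/hasP.
by exists (- b); rewrite ?mem_rootsR_mono ?opprK //= !opprK h1 h2.
Qed.

(** An interior position belongs to a multiple root: [multiple_root_pair] factors it as a b,
    [count_ssc_pair] gives the length of its block and [ssc_count_weyl] its place. *)
Lemma inner_ssc n (c d e : R) s bs cs k : pos_seq s -> pos_seq bs ->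
  size s = n -> size bs = n -> size cs = n -> c != 0 -> d != 0 -> e != 0 ->
  pos_seq cs ->
  (exists2 l, l != 0 & ssc n (mono s) (mono bs) = l *: mono cs) ->
  inner (mult_seq (e *: mono cs)) k =
  inner_comp n (mult_seq (c *: mono s)) (mult_seq (d *: mono bs)) k.
Proof.
move=> sp bp sn bn cn c0 d0 e0 cp [l l0 def].
have weyl1 (a b : R) : a \in s -> b \in bs ->
    (count (fun y => a * b < y)%R cs <=
     count (fun y => a < y)%R s + count (fun y => b < y)%R bs)%N.
  move=> sa bb; apply: (@ssc_count_weyl _ false a b l s bs cs) => //.
  - exact: (allP sp).
  - exact: (allP bp).
  - by rewrite bn.
  - by rewrite cn.
  by rewrite sn.
have weyl2 (a b : R) : a \in s -> b \in bs ->
    (count (fun y => y < a * b)%R cs <=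
     count (fun y => y < a)%R s + count (fun y => y < b)%R bs)%N.
  move=> sa bb; apply: (@ssc_count_weyl _ true a b l s bs cs) => //.
  - exact: (allP sp).
  - exact: (allP bp).
  - by rewrite bn.
  - by rewrite cn.
  by rewrite sn.
have total (a : R) (r : seq R) : (count (fun y => a <= y)%R r =
    count (fun y => a < y)%R r + count_mem a r)%N.
  by elim: r => //= y r ->; rewrite le_eqVlt eq_sym; case: ltgtP => _ /=; lia.
have lower (a : R) (r : seq R) : size r = n ->
    (count (fun y => y < a)%R r + count (fun y => a <= y)%R r = n)%N.
  by move=> <-; rewrite total (count_gt_lt a r) addnA.
apply/inner_mult_seqP/inner_comp_mult_seqP => // [[x xc h]|[a [b [sa bb h1 h2]]]].
  have x0 := allP cp x xc.
  have m2 : (1 < mup (- x) (ssc n (mono s) (mono bs)))%N.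
    rewrite def -mul_polyC mupMr ?rootC // mup_mono opprK.
    move: h => /andP[]; rewrite total => h1 h2.
    by rewrite -(ltn_add2l (count (fun y => x < y)%R cs)) addn1 (leq_ltn_trans h1).
  have [|a [b [sa bb /oppr_inj xE nab]]] := multiple_root_pair sp bp sn bn _ m2.
    by rewrite oppr_eq0 lt0r_neq0.
  have := count_ssc_pair sp bp sn bn sa bb l0 def (ltnW nab); rewrite -xE => cx.
  have := weyl1 a b sa bb; have := weyl2 a b sa bb; rewrite -xE => w2 w1.
  move: (lower x cs cn) (lower a s sn) (lower b bs bn) h.
  rewrite (total x cs) (total a s) (total b bs) => lx la lb h.
  exists a, b; rewrite (total a s) (total b bs).
  suff [h1 h2] : (count (fun y => a < y)%R s + count (fun y => b < y)%R bs < k)%N /\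
      (k + n < count (fun y => a < y)%R s + count_mem a s +
               (count (fun y => b < y)%R bs + count_mem b bs))%N by [].
  (* The multiplicity formula makes the totals agree, so both Weyl-type bounds are equalities and
     the block of x starts at the sum of the two starts. *)
  move: cx w2 w1 lx la lb h; rewrite {def weyl1 weyl2 total lower m2 nab}.
  do 9!move: (count _ _) => ?; lia.
(* Conversely, the two bounds place [k] strictly between the counts above and from a b, so a b has
   positive multiplicity. *)
have h1' := weyl1 a b sa bb; have h2' := weyl2 a b sa bb.
have lx := lower (a * b) cs cn; have la := lower a s sn; have lb := lower b bs bn.
have h : (count (fun y => a * b < y)%R cs < k < count (fun y => a * b <= y)%R cs)%N.
  move: h1 h2 h1' h2' lx la lb; do 9!move: (count _ _) => ?; lia.
exists (a * b) => //; rewrite -has_pred1 has_count.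
rewrite -(ltn_add2l (count (fun y => a * b < y)%R cs)) addn0 -total.
by case/andP: h; exact: ltn_trans.
Qed.
End MultSeq.

(** * From polynomials to the operation on ordered partitions *)

Lemma partition_parts n (s : ordered_partition n) : is_ordered_partition n s.
Proof. by case: s. Qed.

Section Assembly.
Variable R : rcfType.
Implicit Types (n : nat).

Lemma schur_szegoE n (p q : {poly R}) :
  schur_szego n p q = n`!%:R^-1 *: ssc n p q.
Proof.
apply/polyP => i; rewrite coefZ coef_ssc coef_poly; case: ltnP => [|_]; last first.
  by rewrite mulr0.
rewrite ltnS => lin; rewrite /binomial_coef -(bin_fact lin) natrM invfM.
have b0 : 'C(n, i)%:R != 0 :> R by rewrite pnatr_eq0 -lt0n bin_gt0.
have f0 : (i`! * (n - i)`!)%:R != 0 :> R.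
  by rewrite pnatr_eq0 -lt0n muln_gt0 !fact_gt0.
by move: (_%:R : R) f0 ('C(n, i)%:R : R) b0 => u u0 v v0; field; rewrite u0 v0.
Qed.

Lemma schur_szegoA n (p q r : {poly R}) :
  schur_szego n p (schur_szego n q r) = schur_szego n (schur_szego n p q) r.
Proof.
apply/polyP => i; rewrite !coef_poly /binomial_coef !coef_poly; case: ifP => // lin.
have b0 : 'C(n, i)%:R != 0 :> R by rewrite pnatr_eq0 -lt0n bin_gt0 -ltnS.
by rewrite /binomial_coef lin; move: ('C(n, i)%:R : R) b0 => u u0; field.
Qed.

Lemma hyp_neg_mono n (P : hyp_neg R n) : exists c s,
  [/\ c != 0, pos_seq s, size s = n & P = c *: mono s :> {poly R}].
Proof.
have [c [s [c0 def sz]]] := size_real_rooted_split (@hyp_real R n P).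
exists c, s; split=> //; last by move: sz; rewrite hyp_size => -[].
apply/allP => a sa; rewrite -oppr_lt0; apply: (@hyp_neg_lt0 R n P).
by rewrite def rootZ // root_mono opprK.
Qed.

Lemma sscZZ n (c d : R) p q : ssc n (c *: p) (d *: q) = (c * d) *: ssc n p q.
Proof. by rewrite linearZ /= sscC linearZ /= sscC scalerA mulrC. Qed.

Section Make.
Variables (n : nat) (p : {poly R}).
Hypothesis H : exists c s, [/\ c != 0, pos_seq s, size s = n & p = c *: mono s].

Lemma mono_hyp_size : size p = n.+1.
Proof. by case: H => c [s [c0 _ <- ->]]; rewrite size_scale // size_mono. Qed.

Lemma mono_hyp_real : real_rooted p.
Proof. by case: H => c [s [c0 _ _ ->]]; exact: real_rooted_mono. Qed.

Lemma mono_hyp_lt0 (x : R) : root p x -> x < 0.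
Proof.
case: H => c [s [c0 /allP sp _ ->]]; rewrite rootZ // root_mono => /sp.
by rewrite oppr_gt0.
Qed.

Definition hyp_neg_of : hyp_neg R n :=
  @HypNeg R n (Hyperbolic mono_hyp_size mono_hyp_real) mono_hyp_lt0.
End Make.

Lemma schur_szego_mono n (P Q : hyp_neg R n) : exists c s,
  [/\ c != 0, pos_seq s, size s = n & schur_szego n P Q = c *: mono s].
Proof.
have [c [s [c0 sp sn defP]]] := hyp_neg_mono P.
have [d [t [d0 tp tn defQ]]] := hyp_neg_mono Q.
have [l [cs [l0 csp csn def]]] := ssc_mono_split sp tp (etrans tn (esym sn)).
rewrite sn in def csn.
exists (n`!%:R^-1 * (c * d * l)), cs; split=> //.
  by rewrite !mulf_neq0 // invr_eq0 pnatr_eq0 -lt0n fact_gt0.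
by rewrite schur_szegoE defP defQ sscZZ def !scalerA ?mulrA.
Qed.

Definition hyp_neg_comp n (P Q : hyp_neg R n) : hyp_neg R n :=
  hyp_neg_of (schur_szego_mono P Q).

Lemma MV_eq n (P Q : hyperbolic R n) : P = Q :> {poly R} -> MV P = MV Q.
Proof. by move=> PQ; apply: val_inj; rewrite /= PQ. Qed.

Lemma inner_schur_szego n (P Q PQ : hyp_neg R n) k :
  PQ = schur_szego n P Q :> {poly R} ->
  inner (mult_seq PQ) k = inner_comp n (mult_seq P) (mult_seq Q) k.
Proof.
have [c [s [c0 sp sn defP]]] := hyp_neg_mono P.
have [d [t [d0 tp tn defQ]]] := hyp_neg_mono Q.
have [e [cs [e0 csp csn defPQ]]] := hyp_neg_mono PQ.
move=> def; rewrite defPQ defP defQ; apply: inner_ssc => //.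
exists (n`!%:R * e / (c * d)).
  by rewrite !mulf_neq0 // ?invr_eq0 ?mulf_neq0 // pnatr_eq0 -lt0n fact_gt0.
have n0 : n`!%:R != 0 :> R by rewrite pnatr_eq0 -lt0n fact_gt0.
move: def; rewrite defPQ defP defQ schur_szegoE sscZZ.
move/(congr1 ( *:%R (n`!%:R / (c * d)))); rewrite !scalerA => h.
rewrite mulrAC h; rewrite -[LHS]scale1r; congr (_ *: _).
by move: (n`!%:R : R) n0 => u u0; field; rewrite u0 c0 d0.
Qed.

(** The two multiplicity vectors fix the interior positions of the composite, and these determine
    its vector by [inner_inj]. *)
Lemma MV_schur_szego n (P Q PQ P' Q' PQ' : hyp_neg R n) :
  PQ = schur_szego n P Q :> {poly R} -> PQ' = schur_szego n P' Q' :> {poly R} ->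
  MV P = MV P' -> MV Q = MV Q' -> MV PQ = MV PQ'.
Proof.
move=> e e' [eP] [eQ]; apply: val_inj => /=.
apply: (@inner_inj n) => [||k _]; try exact: mult_seqP.
by rewrite (inner_schur_szego k e) (inner_schur_szego k e') eP eQ.
Qed.

(** Opposites of the roots of a polynomial realising [s]: the roots are the negatives of 1, ...,
    [size s], and the first part goes with the least root. *)
Fixpoint ladder (s : seq nat) : seq R :=
  if s is m :: s' then nseq m (size s)%:R ++ ladder s' else [::].

Fixpoint rungs (s : seq nat) : seq R :=
  if s is m :: s' then - (size s)%:R :: rungs s' else [::].

Lemma ladder_le s a : a \in ladder s -> 0 < a <= (size s)%:R.
Proof.
elim: s => //= m s IHs; rewrite mem_cat => /orP[/nseqP[-> _]|/IHs/andP[-> h]] /=.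
  by rewrite ltr0Sn lexx.
by rewrite (le_trans h) // ler_nat.
Qed.

Lemma rungs_ge s x : x \in rungs s -> - (size s)%:R <= x.
Proof.
elim: s => //= m s IHs; rewrite inE => /orP[/eqP->//|/IHs].
by apply: le_trans; rewrite lerN2 ler_nat.
Qed.

Lemma mem_rungs s x : all (fun m => 0 < m)%N s ->
  (x \in rungs s) = (- x \in ladder s).
Proof.
elim: s => //= m s IHs /andP[m0 s0]; rewrite inE mem_cat IHs // mem_nseq m0 /=.
by rewrite eqr_oppLR.
Qed.

Lemma sorted_rungs s : sorted <%R (rungs s).
Proof.
elim: s => //= m s IHs; rewrite path_min_sorted //.
apply/allP => x /rungs_ge; apply: lt_le_trans.
by rewrite ltrN2 ltr_nat.
Qed.

Lemma size_ladder s : size (ladder s) = sumn s.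
Proof. by elim: s => //= m s IHs; rewrite size_cat size_nseq IHs. Qed.

Lemma count_rungs s : [seq count_mem (- x) (ladder s) | x <- rungs s] = s.
Proof.
elim: s => //= m s IHs; rewrite opprK count_cat count_nseq /= eqxx mul1n.
rewrite (count_memPn _) ?addn0; last first.
  by apply/negP => /ladder_le/andP[_]; rewrite ler_nat ltnn.
congr cons; rewrite -[RHS]IHs; apply/eq_in_map => x /rungs_ge xs.
rewrite count_cat count_nseq /= (_ : _ == _ = false) //.
by apply/negbTE; rewrite gt_eqF // ltrNl (lt_le_trans _ xs) // ltrN2 ltr_nat.
Qed.

Lemma ladder_mono n (s : ordered_partition n) : exists c t,
  [/\ c != 0, pos_seq t, size t = n & mono (ladder s) = c *: mono t].
Proof.
have /andP[_ /eqP sn] := partition_parts s; exists 1, (ladder s).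
split; rewrite ?oner_neq0 ?scale1r //=.
  by apply/allP => a /ladder_le/andP[].
by rewrite size_ladder.
Qed.

Definition realize n (s : ordered_partition n) : hyp_neg R n :=
  hyp_neg_of (ladder_mono s).

Lemma MV_realize n (s : ordered_partition n) : MV (realize s) = s.
Proof.
apply: val_inj => /=; have /andP[s0 _] := partition_parts s.
rewrite -[mono _]scale1r mult_seq_mono ?oner_neq0 //.
rewrite (_ : rootsR _ = rungs s); first exact: count_rungs.
apply: lt_sorted_eq; [exact: sorted_roots | exact: sorted_rungs | move=> x].
by rewrite mem_rootsR_mono ?oner_neq0 // mem_rungs.
Qed.

(** The product is read off from chosen realizations; [MV_schur_szego] shows independence of the
    choice, and associativity passes from polynomials to partitions. *)
Lemma induced_exists n : exists op : ordered_partition n -> ordered_partition n ->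
  ordered_partition n, associative op /\ induced_by_schur_szego R op.
Proof.
exists (fun s t => MV (hyp_neg_comp (realize s) (realize t))).
have comp_MV (P Q : hyp_neg R n) : MV (hyp_neg_comp (realize (MV P)) (realize (MV Q))) =
    MV (hyp_neg_comp P Q).
  by apply: (@MV_schur_szego _ (realize (MV P)) (realize (MV Q)) _ P Q);
    rewrite ?MV_realize.
split=> [s t u|P Q]; last by exists (hyp_neg_comp P Q).
(* Only the outer arguments are rewritten as vectors of their realizations, so that [comp_MV]
   applies on each side. *)
rewrite -{1}(MV_realize s) -{2}(MV_realize u) !comp_MV.
by apply: MV_eq; exact: schur_szegoA.
Qed.

(** Realizations of [s] and [t] force the value of the operation, and [inner_inj] leaves a finite
    check over k < n that settles numerical examples by evaluation. *)
Lemma induced_unique n op (s t u : ordered_partition n) :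
  induced_by_schur_szego R op ->
  (forall k, (k < n)%N -> inner_comp n s t k = inner u k) -> op s t = u.
Proof.
move=> /(_ (realize s) (realize t)) [PQ [e]]; rewrite !MV_realize => <- h.
apply: val_inj; apply: (@inner_inj n) => [||k kn]; try exact: mult_seqP.
  exact: partition_parts.
have es : mult_seq (realize s) = s := congr1 (@parts n) (MV_realize s).
have et : mult_seq (realize t) = t := congr1 (@parts n) (MV_realize t).
by rewrite -h // -es -et -(inner_schur_szego k e).
Qed.
End Assembly.

Local Close Scope ring_scope.

Theorem corollary1 (R : realType) :
  (forall n : nat, 0 < n ->
     exists op : ordered_partition n -> ordered_partition n ->
                 ordered_partition n,
       associative op /\ induced_by_schur_szego R op) /\
  (forall op : ordered_partition 17 -> ordered_partition 17 ->
               ordered_partition 17,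
     induced_by_schur_szego R op ->
     op (@OrderedPartition 17 [:: 2; 14; 1] isT)
        (@OrderedPartition 17 [:: 5; 6; 6] isT) =
       @OrderedPartition 17 [:: 1; 1; 2; 1; 1; 1; 3; 1; 1; 1; 3; 1] isT /\
     op (@OrderedPartition 17 [:: 1; 14; 2] isT)
        (@OrderedPartition 17 [:: 5; 6; 4; 2] isT) =
       @OrderedPartition 17 [:: 1; 2; 1; 1; 1; 3; 1; 1; 1; 1; 1; 1; 1; 1] isT).
Proof.
split=> [n _|op ind]; first exact: induced_exists.
have check (s t u : ordered_partition 17) :
    all (fun k => inner_comp 17 s t k == inner u k) (iota 0 17) -> op s t = u.
  move=> /allP h; apply: (induced_unique ind) => k k17; apply/eqP/h.
  by rewrite mem_iota.
by split; apply: check; vm_compute.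
Qed.
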